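(* Let $\Lambda$ be a ring and $M$ a finitely presented $\Lambda$-module. Then the following statements are equivalent. (i) $M$ is a silting module, that is, there is $P\in\mathsf{2}\text{-}\mathsf{silt}\,\Lambda$ such that $\mathsf{add}\,H^0(P)=\mathsf{add}\,M$. (ii) There is $P\in\mathsf{2}\text{-}\mathsf{psilt}\,\Lambda$ such that $\mathsf{add}\,H^0(P)=\mathsf{add}\,M$ and there exists an exact sequence $\Lambda\xrightarrow{g}M^0\to M^1\to0$, where $g$ is a left $\mathcal T_P$-approximation and $M^0,M^1\in\mathsf{add}\,M$. (iii) There is $P\in\mathsf{2}\text{-}\mathsf{psilt}\,\Lambda$ such that $\mathsf{add}\,H^0(P)=\mathsf{add}\,M$ and there exists an exact sequence $\Lambda\xrightarrow{g}M^0\to M^1\to0$, where $g$ is a left $(\mathsf{Gen}\,M)$-approximation and $M^0,M^1\in\mathsf{add}\,M$. (iv) There is $P\in\mathsf{2}\text{-}\mathsf{psilt}\,\Lambda$ such that $\mathsf{add}\,H^0(P)=\mathsf{add}\,M$ and there exists an exact sequence $\Lambda\xrightarrow{g}M^0\to M^1\to0$, where $g$ is a left $(\mathsf{add}\,M)$-approximation and $M^0,M^1\in\mathsf{add}\,M$. (v) There is a two-term complex $P\in\mathsf K^{\rm b}(\mathsf{proj}\,\Lambda)$ such that $\mathsf{add}\,H^0(P)=\mathsf{add}\,M$ and $\mathcal T_P=\mathsf{Gen}\,M$.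
   Context: Rings have an identity, modules are left modules. $\mathsf{Mod}\,\Lambda$ is the category of all $\Lambda$-modules, $\mathsf{proj}\,\Lambda$ that of finitely generated projective modules. $\mathsf{add}\,X$ is the category of direct summands of finite direct sums of copies of $X$; $\mathsf{Add}\,M$ is the subcategory of $\mathsf{Mod}\,\Lambda$ of direct summands of arbitrary (possibly infinite) direct sums of copies of $M$; $\mathsf{Gen}\,M$ is the subcategory of $\mathsf{Mod}\,\Lambda$ of factor modules of modules in $\mathsf{Add}\,M$. A two-term complex $P=(P^{-1}\xrightarrow{f}P^0)\in\mathsf K^{\rm b}(\mathsf{proj}\,\Lambda)$ is one with $P^i=0$ for $i\ne-1,0$ (up to isomorphism in $\mathsf K^{\rm b}(\mathsf{proj}\,\Lambda)$), and $\mathcal T_P:=\{X\in\mathsf{Mod}\,\Lambda\mid\operatorname{Hom}_\Lambda(f,X)\text{ is surjective}\}=\{X\in\mathsf{Mod}\,\Lambda\mid\operatorname{Hom}_{\mathsf D(\Lambda)}(P,X[1])=0\}$, where $\mathsf D(\Lambda)$ is the derived category of $\mathsf{Mod}\,\Lambda$. $P\in\mathsf K^{\rm b}(\mathsf{proj}\,\Lambda)$ is presilting if $\operatorname{Hom}(P,P[i])=0$ for all $i>0$, and silting if moreover the smallest triangulated subcategory of $\mathsf K^{\rm b}(\mathsf{proj}\,\Lambda)$ closed under direct summands and containing $P$ is everything. $\mathsf{2}\text{-}\mathsf{psilt}\,\Lambda$ (resp. $\mathsf{2}\text{-}\mathsf{silt}\,\Lambda$) is the set of two-term presilting (resp. silting)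 complexes up to additive equivalence ($\mathsf{add}\,P=\mathsf{add}\,Q$). For a subcategory $\mathcal B$, a left $\mathcal B$-approximation of an object $C$ is a morphism $g:C\to B^0$ with $B^0\in\mathcal B$ such that $\operatorname{Hom}(g,B):\operatorname{Hom}(B^0,B)\to\operatorname{Hom}(C,B)$ is surjective for all $B\in\mathcal B$. *)

(* Defs.v *)
From HB Require Import structures.
From mathcomp Require Import all_boot all_order all_algebra.
From mathcomp Require Import ring_quotient.
From mathcomp Require Import boolp classical_sets functions cardinality.

Set Implicit Arguments.
Unset Strict Implicit.
Unset Printing Implicit Defensive.

Import GRing.Theory.
Local Open Scope ring_scope.

(** A ring is a [pzRingType] (unital, possibly zero), a module is a left
    module [lmodType R].  The [choiceType] carried by an [lmodType] is no
    restriction, by the classical axioms of [boolp]. *)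

Section Modules.
Variable R : pzRingType.
Implicit Types M N X : lmodType R.

Definition is_zero M : Prop := forall x : M, x = 0.

Definition surjective (A B : Type) (f : A -> B) : Prop :=
  forall y, exists x, f x = y.

Definition exact (A B : Type) (C : lmodType R) (f : A -> B) (g : B -> C) :
  Prop := forall y, g y = 0 <-> exists x, f x = y.

Definition lmod_iso M N : Prop := exists f : {linear M -> N}, bijective f.

Definition summand N M : Prop :=
  exists N' : lmodType R, lmod_iso M (N * N')%type.

Definition finitely_generated M : Prop :=
  exists (n : nat) (p : {linear 'rV[R]_n -> M}), surjective p.

Definition finitely_presented M : Prop :=
  exists (m n : nat) (f : {linear 'rV[R]_m -> 'rV[R]_n})
         (p : {linear 'rV[R]_n -> M}), surjective p /\ exact f p.

Definition projective M : Prop :=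
  forall (A B : lmodType R) (q : {linear A -> B}) (f : {linear M -> B}),
    surjective q -> exists g : {linear M -> A}, forall x, q (g x) = f x.

Definition fg_proj M : Prop := finitely_generated M /\ projective M.

End Modules.

(** The direct sum of [I] copies of [M], for an arbitrary type [I]. *)
Section DirectSum.
Variables (R : pzRingType) (I : Type) (M : lmodType R).

Definition finitely_supported : {pred I -> M} :=
  fun f => `[< finite_set [set i | f i != 0] >].

Lemma finitely_supported_submod_closed : submod_closed finitely_supported.
Proof.
split=> [|a f g /asboolP fF /asboolP gF]; apply/asboolP.
  rewrite (_ : [set i | _] = set0)%classic ?finite_set0 // -subset0 => i /=.
  by rewrite eqxx.
apply: (@sub_finite_set _ _ ([set i | f i != 0] `|` [set i | g i != 0])%classic).
  move=> i /=; case: (eqVneq (f i) 0) => [fi0 H|]; last by left.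
  right; apply: contra_neq H => gi0.
  by rewrite -[LHS]/(a *: f i + g i) fi0 gi0 scaler0 addr0.
by rewrite finite_setU.
Qed.

HB.instance Definition _ :=
  GRing.isSubmodClosed.Build R (I -> M) finitely_supported
    finitely_supported_submod_closed.

Record dsum := DSum { dsum_val :> I -> M; _ : dsum_val \in finitely_supported }.

HB.instance Definition _ := [isSub for dsum_val].
HB.instance Definition _ := [Choice of dsum by <:].
HB.instance Definition _ := [SubChoice_isSubLmodule of dsum by <:].

End DirectSum.

Section AddGen.
Variables (R : pzRingType) (M : lmodType R).

Definition in_add (N : lmodType R) : Prop :=
  exists n : nat, summand N {ffun 'I_n -> M}.

Definition in_Add (N : lmodType R) : Prop :=
  exists I : Type, summand N (dsum I M).

Definition in_Gen (X : lmodType R) : Prop :=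
  exists (N : lmodType R) (p : {linear N -> X}), in_Add N /\ surjective p.

End AddGen.

Definition add_eq (R : pzRingType) (M N : lmodType R) : Prop :=
  forall X : lmodType R, in_add M X <-> in_add N X.

Definition left_approx (R : pzRingType) (B : lmodType R -> Prop)
    (C B0 : lmodType R) (g : {linear C -> B0}) : Prop :=
  B B0 /\
  forall (B' : lmodType R) (h : {linear C -> B'}), B B' ->
    exists k : {linear B0 -> B'}, forall x, k (g x) = h x.

Section LmodQuotient.
Local Open Scope quotient_scope.
Variables (R : pzRingType) (V : lmodType R) (S : submodClosed V).

(** A copy of [S] closed also under opposites, as required by
    [Quotient.quot]. *)
Definition submod_pred : {pred V} := S.

Fact submod_pred_zmod_closed : zmod_closed submod_pred.
Proof. exact: GRing.submod_closedB (submodClosedP S). Qed.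

HB.instance Definition _ :=
  GRing.isZmodClosed.Build V submod_pred submod_pred_zmod_closed.

Definition lmod_quot := Quotient.quot submod_pred.

HB.instance Definition _ := GRing.Zmodule.on lmod_quot.

Definition quot_proj (x : V) : lmod_quot := \pi_(Quotient.quot submod_pred) x.

Definition quot_scale (a : R) (q : lmod_quot) : lmod_quot :=
  quot_proj (a *: repr (q : Quotient.quot submod_pred)).

Lemma quot_projE x y : quot_proj x = quot_proj y <-> x - y \in S.
Proof.
rewrite -[_ \in S]/(x - y \in submod_pred) Quotient.idealrBE.
by split=> [H|/eqP//]; apply/eqP.
Qed.

Lemma quot_projK (q : lmod_quot) :
  quot_proj (repr (q : Quotient.quot submod_pred)) = q.
Proof. exact: reprK. Qed.

Lemma quot_projD : {morph quot_proj : x y / x + y}.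
Proof. by move=> x y; rewrite /quot_proj raddfD. Qed.

Lemma quot_projZ a x : quot_scale a (quot_proj x) = quot_proj (a *: x).
Proof.
by apply/quot_projE; rewrite -scalerBr rpredZ //; apply/quot_projE/quot_projK.
Qed.

Fact quot_scaleA a b q : quot_scale a (quot_scale b q) = quot_scale (a * b) q.
Proof. by rewrite -(quot_projK q) !quot_projZ scalerA. Qed.

Fact quot_scale1 : left_id 1 quot_scale.
Proof. by move=> q; rewrite -(quot_projK q) quot_projZ scale1r. Qed.

Fact quot_scaleDr : right_distributive quot_scale +%R.
Proof.
move=> a p q; rewrite -(quot_projK p) -(quot_projK q).
by rewrite -quot_projD !quot_projZ scalerDr quot_projD.
Qed.

Fact quot_scaleDl q : {morph quot_scale^~ q : a b / a + b}.
Proof.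
by move=> a b; rewrite -(quot_projK q) !quot_projZ scalerDl quot_projD.
Qed.

HB.instance Definition _ := GRing.Zmodule_isLmodule.Build R lmod_quot
  quot_scaleA quot_scale1 quot_scaleDr quot_scaleDl.

End LmodQuotient.

Section Homology.
Variables (R : pzRingType) (U V W : lmodType R).
Variables (f : {linear U -> V}) (g : {linear V -> W}).

Definition ker_pred : {pred V} := fun v => g v == 0.

Fact ker_submod_closed : submod_closed ker_pred.
Proof.
split=> [|a x y /eqP x0 /eqP y0]; apply/eqP; first exact: linear0.
by rewrite linearP x0 y0 scaler0 addr0.
Qed.

HB.instance Definition _ :=
  GRing.isSubmodClosed.Build R V ker_pred ker_submod_closed.

Record ker := Ker { ker_val :> V; _ : ker_val \in ker_pred }.

HB.instance Definition _ := [isSub for ker_val].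
HB.instance Definition _ := [Choice of ker by <:].
HB.instance Definition _ := [SubChoice_isSubLmodule of ker by <:].

Definition im_pred : {pred ker} := fun z => `[< exists u, f u = val z >].

Fact im_submod_closed : submod_closed im_pred.
Proof.
split=> [|a x y /asboolP[u fu] /asboolP[v fv]]; apply/asboolP.
  by exists 0; rewrite !linear0.
by exists (a *: u + v); rewrite !linearP fu fv.
Qed.

HB.instance Definition _ :=
  GRing.isSubmodClosed.Build R ker im_pred im_submod_closed.

Definition homology := lmod_quot im_pred.
HB.instance Definition _ := GRing.Lmodule.on homology.

End Homology.

Section Complexes.
Variable R : pzRingType.

Record complex := Complex {
  ob :> int -> lmodType R;
  diff : forall i : int, {linear ob i -> ob (i + 1)};
  diffK : forall (i : int) (x : ob i), diff (i + 1) (diff i x) = 0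
}.

Record chain_map (X Y : complex) := ChainMap {
  cmap :> forall i : int, {linear X i -> Y i};
  cmapE : forall (i : int) (x : X i),
    diff Y i (cmap i x) = cmap (i + 1) (diff X i x)
}.

(** Every integer is of the form [i + 1], so that the equation below is the
    usual [f - g = d h + h d] in all degrees. *)
Definition homotopic (X Y : complex) (f g : forall i : int, X i -> Y i) :
    Prop :=
  exists h : forall i : int, {linear X (i + 1) -> Y i},
  forall (i : int) (x : X (i + 1)),
    f (i + 1) x - g (i + 1) x = diff Y i (h i x) + h (i + 1) (diff X (i + 1) x).

Definition null_homotopic (X Y : complex) (f : chain_map X Y) : Prop :=
  @homotopic X Y (fun i => f i) (fun=> fun=> 0).

Definition isoK (X Y : complex) : Prop :=
  exists (f : chain_map X Y) (g : chain_map Y X),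
    @homotopic X X (fun i x => g i (f i x)) (fun=> id) /\
    @homotopic Y Y (fun i y => f i (g i y)) (fun=> id).

Definition in_Kbproj (X : complex) : Prop :=
  (forall i : int, fg_proj (X i)) /\
  exists n : nat, forall i : int, (n < `|i|)%N -> is_zero (X i).

Section Shift.
Variable X : complex.

Definition shift_diff (i : int) : {linear X (i + 1) -> X (i + 1 + 1)} :=
  \- diff X (i + 1).

Fact shift_diffK i x : shift_diff (i + 1) (shift_diff i x) = 0.
Proof. by rewrite /= linearN opprK diffK. Qed.

Definition shift : complex :=
  @Complex (fun i => X (i + 1)) shift_diff shift_diffK.
End Shift.

Section DirectSum2.
Variables X Y : complex.

Definition sum_diff_fun (i : int) (z : X i * Y i) : X (i + 1) * Y (i + 1) :=
  (diff X i z.1, diff Y i z.2).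

Fact sum_diff_linear i : linear (@sum_diff_fun i).
Proof. by move=> a u v; rewrite /sum_diff_fun /= !linearP. Qed.

HB.instance Definition _ i := GRing.isLinear.Build R _ _ _ (@sum_diff_fun i)
  (@sum_diff_linear i).

Fact sum_diffK i z : @sum_diff_fun (i + 1) (@sum_diff_fun i z) = 0.
Proof. by rewrite /sum_diff_fun /= !diffK. Qed.

Definition csum : complex :=
  @Complex (fun i => (X i * Y i)%type) (fun i => @sum_diff_fun i) sum_diffK.
End DirectSum2.

Section Cone.
Variables (X Y : complex) (f : chain_map X Y).

Definition cone_diff_fun (i : int) (z : X (i + 1) * Y i) :
    X (i + 1 + 1) * Y (i + 1) :=
  (- diff X (i + 1) z.1, f (i + 1) z.1 + diff Y i z.2).

Fact cone_diff_linear i : linear (@cone_diff_fun i).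
Proof.
move=> a u v; congr (_, _); rewrite /= !linearP //=.
by rewrite scalerDr addrACA.
Qed.

HB.instance Definition _ i := GRing.isLinear.Build R _ _ _ (@cone_diff_fun i)
  (@cone_diff_linear i).

Fact cone_diffK i z : @cone_diff_fun (i + 1) (@cone_diff_fun i z) = 0.
Proof.
rewrite /cone_diff_fun /= linearN diffK !oppr0 linearN linearD diffK addr0.
by rewrite cmapE addNr.
Qed.

Definition cone : complex :=
  @Complex (fun i => (X (i + 1)%R * Y i)%type) (fun i => @cone_diff_fun i)
    cone_diffK.
End Cone.

(** Full triangulated subcategories of [K^b(proj R)], closed under isomorphism
    and direct summands, given by their classes of objects.  Closure under the
    inverse shift is [thick_unshift]. *)
Record thick (C : complex -> Prop) : Prop := Thick {
  thick_sub : forall X, C X -> in_Kbproj X;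
  thick_iso : forall X Y, in_Kbproj Y -> isoK X Y -> C X -> C Y;
  thick_shift : forall X, C X -> C (shift X);
  thick_unshift : forall X, in_Kbproj X -> C (shift X) -> C X;
  thick_cone : forall X Y (f : chain_map X Y), C X -> C Y -> C (cone f);
  thick_summand : forall X Y, in_Kbproj X -> in_Kbproj Y ->
    C (csum X Y) -> C X
}.

Definition presilting (P : complex) : Prop :=
  in_Kbproj P /\
  forall (n : nat) (f : chain_map P (iter n.+1 shift P)), null_homotopic f.

Definition silting (P : complex) : Prop :=
  presilting P /\
  forall C, thick C -> C P -> forall X, in_Kbproj X -> C X.

(** [Q] is an honest complex [Q^-1 -> Q^0] isomorphic to [P] in
    [K^b(proj R)]. *)
Definition two_term_model (P Q : complex) : Prop :=
  [/\ in_Kbproj Q, forall i : int, i != -1 -> i != 0 -> is_zero (Q i)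
    & isoK P Q].

Definition two_term (P : complex) : Prop :=
  in_Kbproj P /\ exists Q, two_term_model P Q.

Definition two_psilt (P : complex) : Prop := two_term P /\ presilting P.

Definition two_silt (P : complex) : Prop := two_term P /\ silting P.

(** The class [T_P] of a two-term complex [P]: [Hom(f, X)] is surjective, for
    [f : Q^-1 -> Q^0] a model of [P].  As [f] is determined by [P] up to
    homotopy equivalence, this does not depend on the model. *)
Definition torsion (P : complex) (X : lmodType R) : Prop :=
  exists Q, two_term_model P Q /\
    forall u : {linear Q (-1) -> X}, exists v : {linear Q 0 -> X},
      forall y, v (diff Q (-1) y) = u y.

Definition H0 (P : complex) : lmodType R := homology (diff P (-1)) (diff P 0).

End Complexes.

Section Silting.
Variables (R : pzRingType) (M : lmodType R).

Definition silting_module : Prop :=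
  exists P : complex R, two_silt P /\ add_eq (H0 P) M.

(** There is an exact sequence [R -g-> M0 -> M1 -> 0] with [g] a left
    [B]-approximation and [M0], [M1] in [add M]. *)
Definition has_approx_seq (B : lmodType R -> Prop) : Prop :=
  exists (M0 M1 : lmodType R) (g : {linear R^o -> M0}) (p : {linear M0 -> M1}),
    [/\ exact g p, surjective p, left_approx B g, in_add M M0 & in_add M M1].

End Silting.

(* Main.v *)
From HB Require Import structures.
From mathcomp Require Import all_boot all_order all_algebra.
From mathcomp Require Import zify.
From mathcomp Require Import boolp classical_sets functions cardinality.
Require Import Defs.

Set Implicit Arguments.
Unset Strict Implicit.
Unset Printing Implicit Defensive.

Import GRing.Theory.
Local Open Scope ring_scope.

(** Let [f : A -> B] be a model of [P], with cokernel [N = H^0(P)].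

    If [P] is silting and [X] is in [T_P], then [X] modulo the trace of [N] in
    [X] has no maps from any shift of [P], hence none from any perfect complex,
    and so it vanishes: [T_P = Gen N].

    Suppose [T_P = Gen N].  As [T_P] is closed under products, the identity of
    [N] is an element of [N^N] that lies in the trace of [N]; it is therefore
    the image of some [z] in some power [N^n], and [1 |-> z] is a left
    [T_P]-approximation of [R].  Its cokernel [X] is a summand of a direct sum
    of copies of [N], because the kernel of the universal map from such a sum to
    [X] lies in [T_P].  Moreover [X] is presented by the map
    [q : A^n x R -> B^n] that is [f^n] on [A^n] and sends [1] to a lift of [z],
    and the direct sum of [f^n] and [q] is silting: [R] is the cocone of the
    inclusion of [f^n] into [q].

    A module [Y] in [T_P] lies in [T_q] if and only if each of its elements is
    the image of [z] under some map [N^n -> Y].  Hence, when [P] is presilting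
    and [1 |-> z] is merely a left [add N]-approximation, the class of the
    direct sum of [f] and [q] is [Gen N]. *)

(** * Modules *)

Section LinearMaps.
Variable R : pzRingType.
Implicit Types L M N U V W X : lmodType R.

Definition mklin U V (f : U -> V) (fl : linear f) : {linear U -> V} :=
  HB.pack f (GRing.isLinear.Build R U V *:%R f fl).

Fact lin_pair_subproof U V W (f : {linear U -> V}) (g : {linear U -> W}) :
  linear (fun x => (f x, g x)).
Proof. by move=> a x y; rewrite !linearP. Qed.
Definition lin_pair U V W (f : {linear U -> V}) (g : {linear U -> W}) :=
  mklin (lin_pair_subproof f g).

Fact lin_copair_subproof U V W (f : {linear U -> W}) (g : {linear V -> W}) :
  linear (fun x : U * V => f x.1 + g x.2).
Proof. by move=> a x y; rewrite /= !linearP addrACA scalerDr. Qed.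
Definition lin_copair U V W (f : {linear U -> W}) (g : {linear V -> W}) :=
  mklin (lin_copair_subproof f g).

Fact lin_elt_subproof V (v : V) : linear (fun r : R^o => (r : R) *: v).
Proof. by move=> a r s /=; rewrite scalerDl scalerA. Qed.
Definition lin_elt V (v : V) : {linear R^o -> V} := mklin (lin_elt_subproof v).

Lemma lin_eltE V (g : {linear R^o -> V}) (r : R) : g r = r *: g 1.
Proof. by rewrite -linearZ /= -[r *: _]/(r * 1) mulr1. Qed.

Section Finfun.
Variable I : finType.

Fact lin_coord_subproof M i : linear (fun z : {ffun I -> M} => z i).
Proof. by move=> a x y; rewrite !ffunE. Qed.
Definition lin_coord M i : {linear {ffun I -> M} -> M} :=
  mklin (@lin_coord_subproof M i).

Fact lin_tuple_subproof X M (h : I -> {linear X -> M}) :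
  linear (fun x => [ffun i => h i x]).
Proof. by move=> a x y; apply/ffunP=> i; rewrite !ffunE linearP. Qed.
Definition lin_tuple X M (h : I -> {linear X -> M}) :
    {linear X -> {ffun I -> M}} :=
  mklin (lin_tuple_subproof h).

Fact lin_cotuple_subproof X M (h : I -> {linear M -> X}) :
  linear (fun z : {ffun I -> M} => \sum_i h i (z i)).
Proof.
move=> a x y; rewrite scaler_sumr -big_split; apply: eq_bigr => i _ /=.
by rewrite !ffunE linearP.
Qed.
Definition lin_cotuple X M (h : I -> {linear M -> X}) :
    {linear {ffun I -> M} -> X} :=
  mklin (lin_cotuple_subproof h).

Fact lin_inj_subproof M (i : I) :
  linear (fun m : M => [ffun j : I => if j == i then m else 0]).
Proof.
move=> a x y; apply/ffunP=> j; rewrite !ffunE.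
by case: ifP => // _; rewrite scaler0 addr0.
Qed.
Definition lin_inj M i : {linear M -> {ffun I -> M}} :=
  mklin (@lin_inj_subproof M i).

Lemma ffun_sum_inj M (z : {ffun I -> M}) : z = \sum_i lin_inj M i (z i).
Proof.
apply/ffunP=> j; rewrite sum_ffunE (bigD1 j) //= !ffunE eqxx big1 ?addr0 //.
by move=> i /negPf ij; rewrite ffunE eq_sym ij.
Qed.

Lemma lin_ffunE M X (c : {linear {ffun I -> M} -> X}) z :
  c z = \sum_i c (lin_inj M i (z i)).
Proof. by rewrite {1}(ffun_sum_inj z) linear_sum. Qed.

Definition lin_map M N (f : {linear M -> N}) :
    {linear {ffun I -> M} -> {ffun I -> N}} :=
  lin_tuple (fun i => f \o lin_coord M i).

End Finfun.

(** A set-theoretic section of [p] is enough: [u] is constant on the fibres of [p], so its composite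
    with the section is linear. *)
Lemma factor_surj U V W (p : {linear U -> V}) (u : {linear U -> W}) :
    surjective p -> (forall x, p x = 0 -> u x = 0) ->
  exists v : {linear V -> W}, forall x, v (p x) = u x.
Proof.
move=> p_surj keru; have [s sK] := choice p_surj.
have us x y : p x = p y -> u x = u y.
  by move=> e; apply/subr0_eq; rewrite -linearB keru // linearB e subrr.
have vl : linear (fun y => u (s y)).
  by move=> a x y; rewrite -linearP; apply: us; rewrite linearP !sK.
by exists (mklin vl) => x /=; apply: us; rewrite sK.
Qed.

Lemma bij_linear U V (f : {linear U -> V}) :
  bijective f -> exists g : {linear V -> U}, cancel f g /\ cancel g f.
Proof.
move=> [g fK gK]; have gl : linear g.
  by move=> a x y; apply: (can_inj fK); rewrite linearP !gK.
by exists (mklin gl).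
Qed.

Lemma lmod_isoP U V : lmod_iso U V <->
  exists (f : {linear U -> V}) (g : {linear V -> U}), cancel f g /\ cancel g f.
Proof.
split=> [[f /bij_linear[g fg]]|[f [g [fK gK]]]]; first by exists f, g.
by exists f; exists g.
Qed.

Lemma lmod_iso_sym U V : lmod_iso U V -> lmod_iso V U.
Proof.
by move=> /lmod_isoP[f [g [fK gK]]]; apply/lmod_isoP; exists g, f.
Qed.

Lemma lmod_iso_trans V U W : lmod_iso U V -> lmod_iso V W -> lmod_iso U W.
Proof.
by move=> [f fb] [g gb]; exists (g \o f); apply: bij_comp.
Qed.

(** Summands in split form, without a named complement; [summand_retract] recovers the complement as
    the kernel of the retraction. *)
Definition retract N M : Prop :=
  exists (i : {linear N -> M}) (r : {linear M -> N}), cancel i r.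

Lemma retract_refl M : retract M M.
Proof. by exists idfun, idfun. Qed.

Lemma retract_trans M L N : retract L M -> retract M N -> retract L N.
Proof.
move=> [i [r irK]] [j [s jsK]]; exists (j \o i), (r \o s) => x /=.
by rewrite jsK irK.
Qed.

Lemma lmod_iso_retract M N : lmod_iso M N -> retract M N.
Proof. by move=> /lmod_isoP[f [g [fK _]]]; exists f, g. Qed.

Section Kernel.
Variables (V W : lmodType R) (g : {linear V -> W}).

Lemma ker_valP (x : ker g) : g (ker_val x) = 0.
Proof. by case: x => v /= /eqP. Qed.

Definition to_ker (v : V) (gv : g v = 0) : ker g :=
  Ker (introT eqP gv : v \in ker_pred g).

Fact ker_val_subproof : linear (@ker_val R V W g).
Proof. by []. Qed.
Definition ker_incl := mklin ker_val_subproof.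

Lemma ker_lift U (u : {linear U -> V}) : (forall x, g (u x) = 0) ->
  exists w : {linear U -> ker g}, forall x, ker_val (w x) = u x.
Proof.
move=> gu; have wl : linear (fun x => to_ker (gu x)).
  by move=> a x y; apply: val_inj; rewrite /= linearP.
by exists (mklin wl).
Qed.

End Kernel.

Lemma retract_iso N M (i : {linear N -> M}) (r : {linear M -> N}) :
  cancel i r -> lmod_iso M (N * ker r)%type.
Proof.
move=> irK.
have [w wE] : exists w : {linear M -> ker r},
    forall x, ker_val (w x) = x - i (r x).
  apply: (@ker_lift _ _ r M (idfun \- (i \o r))) => x /=.
  by rewrite linearB irK subrr.
apply/lmod_isoP; exists (lin_pair r w), (lin_copair i (ker_incl r)).
split=> [x|[x y]] /=; first by rewrite wE addrC subrK.
have ry := ker_valP y.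
congr (_, _); first by rewrite linearD irK ry addr0.
apply: val_inj; rewrite /= wE /= linearD irK ry addr0.
by rewrite addrC addKr.
Qed.

Lemma summand_retract N M : summand N M <-> retract N M.
Proof.
split=> [[N' /lmod_isoP[f [g [fK gK]]]]|[i [r irK]]]; last first.
  by exists (ker r); apply: retract_iso irK.
exists (g \o lin_pair idfun \0), (fst \o f) => x /=.
by rewrite gK.
Qed.

Lemma in_add_ffun (I : finType) M : in_add M {ffun I -> M}.
Proof.
exists #|I|; apply/summand_retract.
exists (lin_tuple (fun j => lin_coord M (enum_val j))),
  (lin_tuple (fun i => lin_coord M (enum_rank i))) => z.
by apply/ffunP=> i; rewrite /= !ffunE enum_rankK.
Qed.

Lemma in_add_retract M N L : retract L N -> in_add M N -> in_add M L.
Proof.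
move=> LN [n /summand_retract NM]; exists n; apply/summand_retract.
exact: retract_trans NM.
Qed.

Lemma in_add_refl M : in_add M M.
Proof.
apply: (@in_add_retract _ {ffun 'I_1 -> M}); last exact: in_add_ffun.
exists (lin_inj M ord0), (lin_coord M ord0) => x /=.
by rewrite ffunE eqxx.
Qed.

Lemma in_add_prod M L N : in_add M L -> in_add M N -> in_add M (L * N)%type.
Proof.
move=> [m /summand_retract[i [r irK]]] [n /summand_retract[j [s jsK]]].
apply: (@in_add_retract _ {ffun 'I_m + 'I_n -> M}); last exact: in_add_ffun.
exists (lin_tuple (fun k => match k with
    | inl a => lin_coord M a \o i \o fst | inr b => lin_coord M b \o j \o snd
    end : {linear _ -> M})).
exists (lin_pair (r \o lin_tuple (fun a => lin_coord M (inl a)))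
                 (s \o lin_tuple (fun b => lin_coord M (inr b)))) => -[x y] /=.
rewrite -[x in RHS]irK -[y in RHS]jsK.
by congr (r _, s _); apply/ffunP=> k; rewrite !ffunE.
Qed.

Lemma in_add_trans N M L : in_add M N -> in_add N L -> in_add M L.
Proof.
move=> [m /summand_retract[i [r irK]]] [n /summand_retract LN].
apply: in_add_retract LN _.
apply: (@in_add_retract _ {ffun 'I_n * 'I_m -> M}); last exact: in_add_ffun.
exists (lin_tuple (fun k => lin_coord M k.2 \o i \o lin_coord N k.1)).
exists (lin_tuple (fun k => r \o lin_tuple (fun l => lin_coord M (k, l)))) => z.
apply/ffunP=> k; rewrite ffunE /= -[RHS]irK; congr (r _).
by apply/ffunP=> l; rewrite !ffunE.
Qed.

Lemma add_eqP M N : add_eq M N <-> in_add N M /\ in_add M N.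
Proof.
split=> [MN|[NM MN] X]; first by split; apply/MN; apply: in_add_refl.
by split; apply: in_add_trans.
Qed.

Lemma add_eq_sym M N : add_eq M N -> add_eq N M.
Proof. by move=> MN X; split=> /MN. Qed.

Lemma add_eq_trans N M L : add_eq M N -> add_eq N L -> add_eq M L.
Proof. by move=> MN NL X; split=> [/MN/NL|/NL/MN]. Qed.

Lemma lmod_iso_add_eq M N : lmod_iso M N -> add_eq M N.
Proof.
move=> MN; apply/add_eqP.
split; apply: in_add_retract (in_add_refl _); apply: lmod_iso_retract => //.
exact: lmod_iso_sym.
Qed.

Lemma is_zero_retract M N : is_zero M -> is_zero N -> lmod_iso M N.
Proof.
move=> M0 N0; apply/lmod_isoP; exists \0, \0.
by split=> x; [rewrite [RHS]M0|rewrite [RHS]N0].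
Qed.

Lemma fg_retract M N : retract N M -> finitely_generated M ->
  finitely_generated N.
Proof.
move=> [i [r irK]] [n [p ps]]; exists n, (r \o p) => y.
by have [x xE] := ps (i y); exists x; rewrite /= xE irK.
Qed.

Lemma fg_surj M N (q : {linear M -> N}) : surjective q ->
  finitely_generated M -> finitely_generated N.
Proof.
move=> qs [n [p ps]]; exists n, (q \o p) => y.
by have [x <-] := qs y; have [v <-] := ps x; exists v.
Qed.

Lemma projective_retract M N : retract N M -> projective M -> projective N.
Proof.
move=> [i [r irK]] Mp A B q f qs.
have [g gE] := Mp A B q (f \o r) qs.
by exists (g \o i) => x; rewrite /= gE /= irK.
Qed.

Lemma fg_proj_retract M N : retract N M -> fg_proj M -> fg_proj N.
Proof.
move=> NM [fM pM]; split; first exact: fg_retract fM.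
exact: projective_retract pM.
Qed.

Lemma fg_proj_iso M N : lmod_iso M N -> fg_proj M -> fg_proj N.
Proof. by move/lmod_iso_sym/lmod_iso_retract; apply: fg_proj_retract. Qed.

Lemma fg_proj_R : fg_proj (R^o : lmodType R).
Proof.
split=> [|A B q f qs].
  have pl : linear (fun x : 'rV[R]_1 => x 0 0 : R^o).
    by move=> a x y; rewrite !mxE.
  by exists 1, (mklin pl) => y; exists (\row_j y); rewrite /= mxE.
have [a aE] := qs (f 1).
by exists (lin_elt a) => r; rewrite /= linearZ aE [RHS]lin_eltE.
Qed.

Lemma fg_proj_zero M : is_zero M -> fg_proj M.
Proof.
move=> M0; split=> [|A B q f qs].
  by exists 0, \0 => y; exists 0; rewrite [RHS]M0.
by exists \0 => x; rewrite [x]M0 !linear0.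
Qed.

Lemma fg_proj_prod M N : fg_proj M -> fg_proj N -> fg_proj (M * N)%type.
Proof.
move=> [[m [p ps]] Mp] [[n [q qs]] Np]; split=> [|A B c f cs].
  exists (m + n)%N, (lin_pair (p \o lsubmx) (q \o rsubmx)) => -[x y].
  have [u <-] := ps x; have [v <-] := qs y; exists (row_mx u v).
  by rewrite /= row_mxKl row_mxKr.
have [g gE] := Mp A B c (f \o lin_pair idfun \0) cs.
have [h hE] := Np A B c (f \o lin_pair \0 idfun) cs.
exists (lin_copair g h) => -[x y] /=.
rewrite linearD gE hE /= -linearD; congr (f _).
by congr (_, _); rewrite ?addr0 ?add0r.
Qed.

Lemma fg_proj_ffun (I : finType) M : fg_proj M -> fg_proj {ffun I -> M}.
Proof.
move=> [[m [p ps]] Mp]; split=> [|A B c f cs].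
  exists (#|I| * m)%N.
  exists (lin_tuple (fun i => p \o row (enum_rank i) \o vec_mx)) => z.
  have [s sE] := choice (fun i => ps (z i)).
  exists (mxvec (\matrix_i s (enum_val i))); apply/ffunP=> i.
  by rewrite ffunE /= mxvecK rowK enum_rankK sE.
have [g gE] := choice (fun i => Mp A B c (f \o lin_inj M i) cs).
exists (lin_cotuple g) => z /=; rewrite linear_sum lin_ffunE.
by apply: eq_bigr => i _; rewrite gE.
Qed.

Lemma fg_proj_rV n : fg_proj 'rV[R]_n.
Proof.
have RI := @fg_proj_ffun 'I_n _ fg_proj_R; apply: fg_proj_retract RI.
have fl : linear (fun x : 'rV[R]_n => [ffun i => x 0 i : R^o]).
  by move=> a x y; apply/ffunP=> i; rewrite !ffunE !mxE.
have gl : linear (fun z : {ffun 'I_n -> R^o} => \row_i z i : 'rV[R]_n).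
  by move=> a x y; apply/rowP=> i; rewrite !mxE !ffunE.
by exists (mklin fl), (mklin gl) => x; apply/rowP=> i; rewrite /= mxE ffunE.
Qed.

(** The pullback of [u] along [c] surjects onto the projective module [U]. *)
Lemma projective_lift U V W (u : {linear U -> W}) (c : {linear V -> W}) :
    projective U -> (forall x, exists z, c z = u x) ->
  exists w : {linear U -> V}, forall x, c (w x) = u x.
Proof.
move=> Up cov; pose h := lin_copair u (\- c).
have [|s sE] := Up (ker h) U (fst \o ker_incl h) idfun.
  move=> x; have [z zE] := cov x.
  have hz : h (x, z) = 0 by rewrite /= zE subrr.
  by exists (to_ker hz).
exists (snd \o ker_incl h \o s) => x /=.
have /= := ker_valP (s x); have /= -> := sE x.
by move/eqP; rewrite subr_eq0 => /eqP ->.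
Qed.

End LinearMaps.

(** * Cokernel presentations and the classes [Tors f] *)

Section Presentation.
Variable R : pzRingType.
Implicit Types A B L M N U V W X Y : lmodType R.

(** Cokernels are characterised by right exactness, so that any isomorphic copy of the quotient can
    serve. *)
Definition coker A B N (f : {linear A -> B}) (p : {linear B -> N}) : Prop :=
  surjective p /\ exact f p.

Lemma coker_comp A B N (f : {linear A -> B}) (p : {linear B -> N}) :
  coker f p -> forall a, p (f a) = 0.
Proof. by move=> [_ fp] a; apply/fp; exists a. Qed.

Lemma coker_lift A B N X (f : {linear A -> B}) (p : {linear B -> N})
    (u : {linear B -> X}) :
    coker f p -> (forall a, u (f a) = 0) ->
  exists v : {linear N -> X}, forall b, v (p b) = u b.
Proof.
by move=> [ps fp] uf; apply: factor_surj => // x /fp[a <-].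
Qed.

Lemma coker_iso A B N N' (f : {linear A -> B}) (p : {linear B -> N})
    (p' : {linear B -> N'}) :
  coker f p -> coker f p' -> lmod_iso N N'.
Proof.
move=> cp cp'; have [v vE] := coker_lift cp (coker_comp cp').
have [w wE] := coker_lift cp' (coker_comp cp).
apply/lmod_isoP; exists v, w; split=> x.
  by have [b <-] := cp.1 x; rewrite vE wE.
by have [b <-] := cp'.1 x; rewrite wE vE.
Qed.

Lemma coker_ffun (I : finType) A B N (f : {linear A -> B})
    (p : {linear B -> N}) :
  coker f p -> coker (lin_map I f) (lin_map I p).
Proof.
move=> cp; split=> [z|z].
  have [s sE] := choice (fun i => cp.1 (z i)).
  by exists [ffun i => s i]; apply/ffunP=> i; rewrite !ffunE /= ffunE sE.
split=> [pz|[x <-]]; last first.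
  by apply/ffunP=> i; rewrite !ffunE /= !ffunE /= (coker_comp cp).
have z0 i : exists a, f a = z i.
  by apply/cp.2; have /ffunP/(_ i) := pz; rewrite !ffunE.
have [s sE] := choice z0.
by exists [ffun i => s i]; apply/ffunP=> i; rewrite !ffunE /= ffunE sE.
Qed.

Lemma coker_sum A B N A' B' N' (f : {linear A -> B}) (p : {linear B -> N})
    (f' : {linear A' -> B'}) (p' : {linear B' -> N'}) :
  coker f p -> coker f' p' ->
  coker (lin_pair (f \o fst) (f' \o snd)) (lin_pair (p \o fst) (p' \o snd)).
Proof.
move=> cp cp'; split=> [[x y]|[x y]].
  by have [b <-] := cp.1 x; have [b' <-] := cp'.1 y; exists (b, b').
split=> /= [[/cp.2[a <-] /cp'.2[a' <-]]|[[a a'] [<- <-]]].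
  by exists (a, a').
by rewrite (coker_comp cp) (coker_comp cp').
Qed.

(** The class [T_P] of the paper, in terms of a model [f] of [P]. *)
Definition Tors A B (f : {linear A -> B}) X : Prop :=
  forall u : {linear A -> X},
  exists v : {linear B -> X}, forall a, v (f a) = u a.

Section Tors.
Variables (A B : lmodType R) (f : {linear A -> B}).

Lemma Tors_retract X Y : retract Y X -> Tors f X -> Tors f Y.
Proof.
move=> [i [r irK]] fX u; have [v vE] := fX (i \o u).
by exists (r \o v) => a; rewrite /= vE /= irK.
Qed.

Lemma Tors_ffun (I : finType) X : Tors f X -> Tors f {ffun I -> X}.
Proof.
move=> fX u; have [v vE] := choice (fun i => fX (lin_coord X i \o u)).
by exists (lin_tuple v) => a; apply/ffunP=> i; rewrite ffunE vE.
Qed.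

Lemma Tors_map_ffun (I : finType) X : Tors f X -> Tors (lin_map I f) X.
Proof.
move=> fX u; have [v vE] := choice (fun i => fX (u \o lin_inj A i)).
exists (lin_cotuple v) => z; rewrite /= lin_ffunE; apply: eq_bigr => i _.
by rewrite ffunE /= vE.
Qed.

(** A single coordinate of the power carries [f]. Over an empty [I] the power is zero and its class
    contains every module. *)
Lemma Tors_ffun_map (I : finType) X : (0 < #|I|)%N ->
  Tors (lin_map I f) X -> Tors f X.
Proof.
move=> /card_gt0P[i _] fX u; have [v vE] := fX (u \o lin_coord A i).
exists (v \o lin_inj B i) => a /=.
have -> : [ffun j => if j == i then f a else 0] = lin_map I f (lin_inj A i a).
  apply/ffunP=> j; rewrite !ffunE /= ffunE; case: ifP => //.
  by rewrite linear0.
by rewrite vE /= ffunE eqxx.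
Qed.

Lemma Tors_add X Y : Tors f X -> in_add X Y -> Tors f Y.
Proof.
move=> fX [n /summand_retract YX]; apply: Tors_retract YX _.
exact: Tors_ffun.
Qed.

Lemma Tors_quotient X Y (q : {linear X -> Y}) :
  projective A -> surjective q -> Tors f X -> Tors f Y.
Proof.
move=> Ap qs fX u; have [w wE] := Ap _ _ q u qs.
by have [v vE] := fX w; exists (q \o v) => a; rewrite /= vE wE.
Qed.

End Tors.

Lemma Tors_sum A B A' B' (f : {linear A -> B}) (f' : {linear A' -> B'}) X :
  Tors (lin_pair (f \o fst) (f' \o snd)) X <-> Tors f X /\ Tors f' X.
Proof.
split=> [ff'|[fX f'X] u].
  split=> u.
    have [v vE] := ff' (u \o fst); exists (v \o lin_pair idfun \0) => a.
    by have := vE (a, 0); rewrite /= linear0.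
  have [v vE] := ff' (u \o snd); exists (v \o lin_pair \0 idfun) => a.
  by have := vE (0, a); rewrite /= linear0.
have [v vE] := fX (u \o lin_pair idfun \0).
have [w wE] := f'X (u \o lin_pair \0 idfun).
exists (lin_copair v w) => -[a a'] /=; rewrite vE wE /= -linearD.
by congr (u (_, _)); rewrite ?addr0 ?add0r.
Qed.

End Presentation.

(** * Direct sums, traces and approximations *)

Section DirectSumTheory.
Variables (R : pzRingType) (I : choiceType) (M : lmodType R).
Implicit Types z : dsum I M.

Lemma dsum_supp z : exists s : seq I, uniq s /\ forall i, z i != 0 -> i \in s.
Proof.
case: z => z zF; have /asboolP/finite_seqP[s sE] := zF; exists (undup s).
rewrite undup_uniq; split=> // i zi; rewrite mem_undup.
by have : [set i | z i != 0]%classic i by []; rewrite sE.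
Qed.

Fact dsum_inj_subproof i (m : M) :
  (fun j : I => if j == i then m else 0) \in @finitely_supported R I M.
Proof.
apply/asboolP; apply: (@sub_finite_set _ _ [set i]%classic) => // j /=.
by case: (eqVneq j i) => // _; rewrite eqxx.
Qed.

Fact dsum_inj_linear i : linear (fun m : M => DSum (dsum_inj_subproof i m)).
Proof.
move=> a x y; apply: val_inj; apply/funext => j /=.
rewrite -[RHS]/(a *: (if j == i then x else 0) + (if j == i then y else 0)).
by case: ifP => // _; rewrite scaler0 addr0.
Qed.
Definition dsum_inj i : {linear M -> dsum I M} := mklin (@dsum_inj_linear i).

Fact dsum_coord_linear i : linear (fun z : dsum I M => z i).
Proof. by []. Qed.
Definition dsum_coord i := mklin (@dsum_coord_linear i).

Lemma dsumE z (s : seq I) : uniq s -> (forall i, z i != 0 -> i \in s) ->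
  z = \sum_(i <- s) dsum_inj i (z i).
Proof.
move=> us zs; apply: val_inj; apply/funext => j.
rewrite -[RHS]/(dsum_coord j _) linear_sum /=.
have [js|js] := boolP (j \in s).
  rewrite (big_rem j) //= eqxx big_seq big1 ?addr0 // => i.
  by rewrite mem_rem_uniq // inE eq_sym => /andP[/negPf->].
rewrite big_seq big1 => [|i is_]; last first.
  by case: (eqVneq j i) is_ => // <-; rewrite (negPf js).
by apply/eqP; apply: contraNT js => /zs.
Qed.

Lemma dsum_eval (X : lmodType R) (h : I -> {linear M -> X}) :
  exists ev : {linear dsum I M -> X}, forall i m, ev (dsum_inj i m) = h i m.
Proof.
have [S SP] := choice dsum_supp.
pose ev z := \sum_(i <- S z) h i (z i).
(* The sum can be taken over any duplicate-free list containing the support; linearity follows by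
   using one list for all three elements. *)
have evE z s : uniq s -> (forall i, z i != 0 -> i \in s) ->
    ev z = \sum_(i <- s) h i (z i).
  move=> us zs; have [uS zS] := SP z.
  have restr r :
      \sum_(i <- r) h i (z i) = \sum_(i <- r | z i != 0) h i (z i).
    rewrite [RHS]big_mkcond; apply: eq_bigr => i _.
    by case: eqP => // ->; rewrite linear0.
  rewrite /ev (restr (S z)) (restr s) -!(big_filter _ (fun i => z i != 0)).
  apply: perm_big; apply: uniq_perm; rewrite ?filter_uniq // => i.
  by rewrite !mem_filter; case: eqP => //= /eqP zi; rewrite zs // zS.
have evl : linear ev.
  move=> a x y; pose s := undup (S (a *: x + y) ++ S x ++ S y).
  have us : uniq s by apply: undup_uniq.
  have sub w : w \in [:: a *: x + y; x; y] -> forall i, w i != 0 -> i \in s.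
    move=> wxy i wi; have [_ wS] := SP w; rewrite mem_undup !mem_cat.
    by move: wxy (wS i wi); rewrite !inE => /or3P[] /eqP-> ->; rewrite ?orbT.
  rewrite !(evE _ s) //; try (apply: sub; rewrite !inE eqxx ?orbT //).
  rewrite scaler_sumr -big_split; apply: eq_bigr => i _ /=.
  exact: linearP.
exists (mklin evl) => i m /=; rewrite (evE _ [:: i]) // => [|j].
  by rewrite big_seq1 /= eqxx.
by rewrite inE /=; case: (j =P i) => //; rewrite eqxx.
Qed.

(** The supports of the images of finitely many generators have a finite union, which contains the
    support of every image. *)
Lemma dsum_supp_fg (Y : lmodType R) (u : {linear Y -> dsum I M}) :
    finitely_generated Y ->
  exists s : seq I, uniq s /\ forall y i, u y i != 0 -> i \in s.
Proof.
move=> [n [p ps]]; have [S SP] := choice dsum_supp.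
pose s := undup (flatten [seq S (u (p (delta_mx 0 k))) | k : 'I_n]).
exists s; split=> [|y i]; first exact: undup_uniq.
have [v <-] := ps y; rewrite [v]row_sum_delta !linear_sum.
apply: contraR => is_; rewrite -[X in X == _]/(dsum_coord i _) linear_sum.
apply/eqP; rewrite big1 // => k _.
rewrite !linearZ -[LHS]/(v 0 k *: u (p (delta_mx 0 k)) i).
rewrite (_ : u _ i = 0) ?scaler0 //; apply/eqP.
apply: contraR is_ => /((SP _).2 i) ki; rewrite mem_undup.
by apply/flattenP; exists (S (u (p (delta_mx 0 k)))); rewrite ?map_f ?mem_enum.
Qed.

End DirectSumTheory.

(** * Traces and modules generated by [N] *)

Section Trace.
Variable R : pzRingType.
Implicit Types A B L M N U V W X Y : lmodType R.

(** Using all sources in [add N] makes every element of the trace a single image; sums are absorbed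
    by products of sources. *)
Definition trace N X (x : X) : Prop :=
  exists (L : lmodType R) (c : {linear L -> X}) (z : L), in_add N L /\ c z = x.

Definition generated_by N X : Prop := forall x : X, trace N x.

Lemma trace_hom N X (h : {linear N -> X}) m : trace N (h m).
Proof. by exists N, h, m; split=> //; apply: in_add_refl. Qed.

Lemma trace0 N X : trace N (0 : X).
Proof. by rewrite -(linear0 (\0 : {linear N -> X})); apply: trace_hom. Qed.

Lemma traceD N X (x y : X) : trace N x -> trace N y -> trace N (x + y).
Proof.
move=> [L [c [z [NL <-]]]] [L' [c' [z' [NL' <-]]]].
exists (L * L')%type, (lin_copair c c'), (z, z'); split=> //.
exact: in_add_prod.
Qed.

Lemma traceZ N X a (x : X) : trace N x -> trace N (a *: x).
Proof.
move=> [L [c [z [NL <-]]]]; exists L, c, (a *: z).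
by rewrite linearZ.
Qed.

Lemma trace_sum N X (I : Type) (s : seq I) (F : I -> X) :
  (forall i, trace N (F i)) -> trace N (\sum_(i <- s) F i).
Proof.
by move=> Ft; apply: big_rec => [|i x _]; [apply: trace0|apply: traceD].
Qed.

Lemma trace_add N M X (x : X) : in_add N M -> trace M x -> trace N x.
Proof.
move=> NM [L [c [z [ML cz]]]]; exists L, c, z; split=> //.
exact: in_add_trans ML.
Qed.

Lemma generated_add N M X : in_add N M -> generated_by M X -> generated_by N X.
Proof. by move=> NM MX x; apply: trace_add (MX x). Qed.

Lemma generated_refl N : generated_by N N.
Proof. by move=> x; apply: (trace_hom idfun). Qed.

Lemma in_add_generated N L : in_add N L -> generated_by N L.
Proof. by move=> NL; apply: generated_add NL (@generated_refl _). Qed.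

Lemma trace_cover_seq N X (s : seq X) : (forall x, x \in s -> trace N x) ->
  exists (L : lmodType R) (c : {linear L -> X}), in_add N L /\
    forall x, x \in s -> exists z, c z = x.
Proof.
elim: s => [|x s IH] sN; first by exists N, \0; split=> //; apply: in_add_refl.
have [y ys|L [c [NL cov]]] := IH; first by apply: sN; rewrite inE ys orbT.
have [L' [c' [z' [NL' cz']]]] := sN x (mem_head _ _).
exists (L' * L)%type, (lin_copair c' c); split; first exact: in_add_prod.
move=> y; rewrite inE => /orP[/eqP->|/cov[z <-]].
  by exists (z', 0); rewrite /= linear0 addr0.
by exists (0, z); rewrite /= linear0 add0r.
Qed.

Lemma trace_cover N A X (u : {linear A -> X}) :
    finitely_generated A -> (forall a, trace N (u a)) ->
  exists (L : lmodType R) (c : {linear L -> X}), in_add N L /\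
    forall a, exists z, c z = u a.
Proof.
move=> [n [p ps]] uN.
have [_ /mapP[k _ ->] //|L [c [NL cov]]] :=
  @trace_cover_seq N X [seq u (p (delta_mx 0 k)) | k : 'I_n].
have {}cov k : exists z, c z = u (p (delta_mx 0 k)).
  by apply: cov; apply/mapP; exists k; rewrite ?mem_enum.
exists L, c; split=> // a; have [v <-] := ps a; have [s sE] := choice cov.
exists (\sum_k v 0 k *: s k); rewrite [v in RHS]row_sum_delta !linear_sum.
by apply: eq_bigr => k _; rewrite !linearZ /= sE.
Qed.

(** Finitely many generators of [A] are covered by one module of [add N], and projectivity turns
    this cover into a lift. *)
Lemma trace_lift N A X (u : {linear A -> X}) :
    fg_proj A -> (forall a, trace N (u a)) ->
  exists (L : lmodType R) (c : {linear L -> X}) (w : {linear A -> L}),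
    in_add N L /\ forall a, c (w a) = u a.
Proof.
move=> [Af Ap] /(trace_cover Af)[L [c [NL cov]]].
by have [w wE] := projective_lift Ap cov; exists L, c, w.
Qed.

(** An element of an infinite direct sum has finite support, hence comes from finitely many copies
    of [N]. Conversely, the universal map from the sum of copies indexed by all maps [N -> X] is
    surjective. *)
Lemma in_GenP N X : in_Gen N X <-> generated_by N X.
Proof.
split=> [[L [p [[I /summand_retract[i [r irK]]] ps]]] x|NX].
  have [y <-] := ps x; rewrite -[y]irK.
  have [s [us zs]] := @dsum_supp R {classic I} N (i y).
  rewrite [i y](dsumE us zs) !linear_sum; apply: trace_sum => k.
  exact: (trace_hom (p \o r \o dsum_inj N (k : {classic I}))).
pose I := {classic {linear N -> X}}.
have [ev evE] := @dsum_eval R I N X id.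
exists (dsum I N), ev; split.
  by exists I; apply/summand_retract; apply: retract_refl.
move=> x; have [L [c [z [[n /summand_retract[i [r irK]]] <-]]]] := NX x.
rewrite -[z]irK [i z]ffun_sum_inj.
exists (\sum_k dsum_inj N (c \o r \o lin_inj N k : I) (i z k)).
by rewrite !linear_sum; apply: eq_bigr => k _; rewrite evE.
Qed.

(** The map [u] lifts to a module of [add N], and the lift extends along [f]. *)
Lemma Tors_generated N A B (f : {linear A -> B}) X :
  fg_proj A -> Tors f N -> generated_by N X -> Tors f X.
Proof.
move=> Ap fN NX u.
have [L [c [w [NL cwE]]]] := trace_lift Ap (fun a => NX (u a)).
have [v vE] := Tors_add fN NL w.
by exists (c \o v) => a; rewrite /= vE.
Qed.

(** [universal_elt N z] says that [1 |-> z] is a left approximation of [R] by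
    the powers of [N]. *)
Definition universal_elt N L (z : L) : Prop :=
  forall m : N, exists g : {linear L -> N}, g z = m.

Lemma universal_trace N L (z : L) X (x : X) :
  universal_elt N z -> trace N x -> exists g : {linear L -> X}, g z = x.
Proof.
move=> zN [L' [c [y [[n /summand_retract[i [r irK]]] <-]]]].
have [g gE] := choice (fun k => zN (i y k)).
exists (c \o r \o lin_tuple g); rewrite /= -[y in RHS]irK; congr (c (r _)).
by apply/ffunP=> k; rewrite ffunE gE.
Qed.

End Trace.

(** * Universal elements and extension of a presentation by one relation *)

Section Approximation.
Variable R : pzRingType.
Variables (A B N : lmodType R) (f : {linear A -> B}) (p : {linear B -> N}).
Hypothesis fp : coker f p.
Implicit Types X : lmodType R.

(** [z] comes from the identity of [N], an element of the product [N -> N] of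
    copies of [N]. *)
Lemma universal_elt_exists :
    (forall X, Tors f X <-> generated_by N X) ->
  exists (I : finType) (z : {ffun I -> N}), (0 < #|I|)%N /\ universal_elt N z.
Proof.
move=> fN; have NT : Tors f N by apply/fN; apply: generated_refl.
pose E : lmodType R := N -> N.
have evl m : linear (fun e : E => e m) by [].
have /fN/(_ id)[L [c [y [[n /summand_retract[i [r irK]]] cy]]]] : Tors f E.
  move=> u; have [v vE] := choice (fun m => NT (mklin (evl m) \o u)).
  have wl : linear ((fun b m => v m b) : B -> E).
    by move=> a x x'; apply/funext => m; rewrite linearP.
  by exists (mklin wl) => a; apply/funext => m /=; rewrite vE.
(* The extra coordinate [None], with value 0, keeps the index type nonempty when [n] is 0. *)
exists (option 'I_n), [ffun o => if o is Some k then i y k else 0].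
split=> [|m]; first by rewrite card_option.
exists (mklin (evl m) \o c \o r \o lin_tuple (fun k => lin_coord N (Some k))).
rewrite /= (_ : [ffun k => _] = i y); last by apply/ffunP=> k; rewrite !ffunE.
by rewrite irK cy.
Qed.

Lemma quotient_universal_in_add X (z : N) (t : {linear N -> X}) :
    fg_proj A -> fg_proj B -> (forall Y, Tors f Y <-> generated_by N Y) ->
    universal_elt N z -> coker (lin_elt z) t ->
  in_add N X.
Proof.
move=> Ap Bp fN zN zt; pose J := {classic {linear N -> X}}.
have NT : Tors f N by apply/fN; apply: generated_refl.
have [ev evE] := @dsum_eval R J N X id.
have FN : generated_by N (dsum J N).
  move=> w; have [s [us ws]] := dsum_supp w.
  by rewrite (dsumE us ws); apply: trace_sum => k; apply: trace_hom.
have tz : t z = 0 by have := coker_comp zt 1; rewrite /= scale1r.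
(* Every map [N -> X] lifts along [ev], which puts [ker ev] in [Tors f]. *)
have KN : generated_by N (ker ev).
  apply/fN => u; have [v vE] := (fN (dsum J N)).2 FN (ker_incl ev \o u).
  have evf a : (ev \o v) (f a) = 0 by rewrite /= vE /= ker_valP.
  have [x xE] := coker_lift fp evf.
  have [b|w wE] := @ker_lift R _ _ ev _ (v \- (dsum_inj N (x : J) \o p)).
    by rewrite [LHS]linearB /= evE xE subrr.
  exists w => a; apply: val_inj; rewrite /= wE /= vE /= (coker_comp fp).
  by rewrite [X in _ - X](linear0 (dsum_inj N (x : J))) subr0.
(* Correcting the inclusion of the copy of [N] indexed by [t] gives a map [s]
   that kills [z], so that [s] induces a section of [ev]; as [N] is finitely
   generated, finitely many copies of [N] suffice. *)
have Kz : ev (dsum_inj N (t : J) z) = 0 by rewrite evE.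
have [h hz] := universal_trace zN (KN (to_ker Kz)).
pose s : {linear N -> dsum J N} := dsum_inj N (t : J) \- (ker_incl ev \o h).
have sz : s z = 0 by rewrite /s /= hz subrr.
have evs x : ev (s x) = t x by rewrite /s linearB evE /= ker_valP subr0.
have Nf : finitely_generated N by apply: fg_surj fp.1 Bp.1.
have [S [uS sS]] := dsum_supp_fg s Nf.
pose e (k : 'I_(size S)) : J := tnth (in_tuple S) k.
pose c := lin_cotuple (fun k => (e k : {linear N -> X})).
pose s' := lin_tuple (fun k => dsum_coord N (e k) \o s).
have cs' x : c (s' x) = t x.
  rewrite -evs [s x in RHS](dsumE uS (sS x)) linear_sum big_tnth.
  by apply: eq_bigr => k _; rewrite evE ffunE.
have [|w wE] := coker_lift zt (u := s').
  move=> r; apply/ffunP=> k; rewrite !ffunE -[LHS]/(s ((r : R) *: z) (e k)).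
  by rewrite linearZ_LR sz scaler0.
exists (size S); apply/summand_retract; exists w, c => x.
by have [y <-] := zt.1 x; rewrite wE cs'.
Qed.

Section Extend.
Variables (z : N) (b : B).
Hypothesis pb : p b = z.
(** One more relation [b], a lift of [z], is imposed on [N], so that the cokernel becomes [N] modulo
    the submodule generated by [z]. *)
Let q := lin_copair f (lin_elt b).

Lemma coker_extend X (t : {linear N -> X}) :
  coker (lin_elt z) t -> coker q (t \o p).
Proof.
move=> zt; split=> [x|x /=].
  by have [y <-] := zt.1 x; have [y' <-] := fp.1 y; exists y'.
split=> [/zt.2[r rE]|[[a r] /= <-]]; last first.
  rewrite !linearD linearZ /= pb (coker_comp fp) linear0 add0r.
  exact: (coker_comp zt r).
have : p (x - (r : R) *: b) = 0 by rewrite linearB linearZ /= pb -rE /= subrr.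
by move=> /fp.2[a aE]; exists (a, r); rewrite /= aE subrK.
Qed.

(** Extend the restriction of [u] to [A] first; the error at [b] is then repaired by a map through
    [p], which does not disturb the values on the image of [f]. *)
Lemma Tors_extend X :
  Tors f X -> (forall x : X, exists g : {linear N -> X}, g z = x) -> Tors q X.
Proof.
move=> fX zX u; have [v vE] := fX (u \o lin_pair idfun \0).
have [g gE] := zX (u (0, 1) - v b).
exists (v \+ (g \o p)) => -[a r] /=.
rewrite !linearD !linearZ /= vE /= pb gE (coker_comp fp) linear0 add0r.
rewrite -addrA -scalerDr [v b + _]addrC subrK -linearZ -linearD.
by congr (u (_, _)); rewrite /= ?scaler0 ?addr0 ?add0r // -[LHS]/(r * 1) mulr1.
Qed.

(** The map that is 0 on [A] and sends 1 to [x] extends to [B]; the extension kills the image of [f]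
    and so factors through [N]. *)
Lemma Tors_extend_universal X :
  Tors q X -> forall x : X, exists g : {linear N -> X}, g z = x.
Proof.
move=> qX x; have [v vE] := qX (lin_elt x \o snd).
have [|g gE] := coker_lift fp (u := v).
  by move=> a; have := vE (a, 0); rewrite /= !scale0r addr0.
exists g; rewrite -pb gE.
by have := vE (0, 1); rewrite /= !scale1r linear0 add0r.
Qed.

End Extend.
End Approximation.

(** * Complexes up to homotopy *)

Section Homology.
Variable R : pzRingType.
Implicit Types U V W X : lmodType R.

Lemma quot_proj_linear V (S : submodClosed V) : linear (@quot_proj R V S).
Proof. by move=> a x y; rewrite quot_projD -quot_projZ. Qed.

Definition lin_quot V (S : submodClosed V) : {linear V -> lmod_quot S} :=
  mklin (@quot_proj_linear V S).

Lemma lin_quot_surj V (S : submodClosed V) : surjective (lin_quot S).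
Proof.
move=> q; exists (repr (q : Quotient.quot (submod_pred S))).
exact: quot_projK.
Qed.

Lemma lin_quot_eq0 V (S : submodClosed V) x : lin_quot S x = 0 <-> x \in S.
Proof.
rewrite -(linear0 (lin_quot S)) -[X in _ <-> X \in _]subr0.
exact: quot_projE.
Qed.

Section Class.
Variables (U V W : lmodType R) (f : {linear U -> V}) (g : {linear V -> W}).

Definition hclass : {linear ker g -> homology f g} :=
  lin_quot (im_pred f (g := g)).

Lemma hclass_surj : surjective hclass.
Proof. exact: lin_quot_surj. Qed.

Lemma hclass_eq0 z : hclass z = 0 <-> exists u, f u = ker_val z.
Proof.
by split=> [/lin_quot_eq0/asboolP|H]; last exact/lin_quot_eq0/asboolP.
Qed.

End Class.

Lemma coker_homology U V W (f : {linear U -> V}) (g : {linear V -> W}) :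
    (forall v, g v = 0) ->
  exists p : {linear V -> homology f g}, coker f p.
Proof.
move=> g0; have [w wE] := @ker_lift R V W g V idfun g0.
exists (hclass f g \o w); split=> [q|v /=].
  have [z <-] := hclass_surj q; exists (ker_val z); congr (hclass f g _).
  by apply: val_inj; rewrite /= wE.
by rewrite hclass_eq0 wE.
Qed.

Lemma homology_map U V W U' V' W'
    (f : {linear U -> V}) (g : {linear V -> W})
    (f' : {linear U' -> V'}) (g' : {linear V' -> W'}) (a : {linear V -> V'}) :
    (forall v, g v = 0 -> g' (a v) = 0) ->
    (forall u, exists u', f' u' = a (f u)) ->
  exists F : {linear homology f g -> homology f' g'},
    forall z z', ker_val z' = a (ker_val z) ->
      F (hclass f g z) = hclass f' g' z'.
Proof.
move=> ag af.
have [|w wE] := @ker_lift R V' W' g' (ker g) (a \o ker_incl g).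
  by move=> z /=; apply/ag/ker_valP.
have [|F FE] := factor_surj (@hclass_surj _ _ _ f g) (u := hclass f' g' \o w).
  by move=> z /hclass_eq0[u uE]; apply/hclass_eq0; rewrite wE /= -uE; apply: af.
exists F => z z' zz'; rewrite FE /=; congr (hclass f' g' _).
by apply: val_inj; rewrite /= wE zz'.
Qed.

End Homology.

(** * Homotopy equivalences, homology and the orthogonal of a module *)

Section ChainMaps.
Variable R : pzRingType.
Implicit Types P Q X Y Z : complex R.

Lemma isoK_sym X Y : isoK X Y -> isoK Y X.
Proof. by move=> [f [g [gf fg]]]; exists g, f. Qed.

Lemma strict_isoK X Y (f : chain_map X Y) (g : forall i, {linear Y i -> X i}) :
  (forall i, cancel (f i) (g i)) -> (forall i, cancel (g i) (f i)) -> isoK X Y.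
Proof.
move=> fK gK.
have gE i (y : Y i) : diff X i (g i y) = g (i + 1) (diff Y i y).
  by apply: (can_inj (fK _)); rewrite -cmapE !gK.
exists f, (ChainMap gE).
by split; exists (fun=> \0) => i x; rewrite /= ?fK ?gK subrr linear0 addr0.
Qed.

Lemma isoK_refl X : isoK X X.
Proof.
have idE i (x : X i) : diff X i (idfun x) = idfun (diff X i x) by [].
pose idX := @ChainMap _ X X (fun i => idfun) idE.
exact: (@strict_isoK _ _ idX (fun i => idfun)).
Qed.

Lemma isoK_H0 X Y : isoK X Y -> lmod_iso (H0 X) (H0 Y).
Proof.
move=> [f [g [[h hE] [k kE]]]].
have mapcond (S T : complex R) (a : chain_map S T) :
    (forall v : S 0, diff S 0 v = 0 -> diff T 0 (a 0 v) = 0) /\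
    (forall u : S (-1), exists u' : T (-1),
      diff T (-1) u' = a 0 (diff S (-1) u)).
  split=> [v v0|u]; first by rewrite cmapE v0 linear0.
  by exists (a (-1) u); apply: cmapE.
have [F FE] := homology_map (mapcond _ _ f).1 (mapcond _ _ f).2.
have [G GE] := homology_map (mapcond _ _ g).1 (mapcond _ _ g).2.
have cycle (S T : complex R) (a : chain_map S T) (z : ker (diff S 0)) :
    exists z' : ker (diff T 0), ker_val z' = a 0 (ker_val z).
  by exists (to_ker ((mapcond _ _ a).1 _ (ker_valP z))).
have back (S T : complex R) (a : chain_map S T) (b : chain_map T S)
    (F1 : {linear H0 S -> H0 T}) (G1 : {linear H0 T -> H0 S}) :
    @homotopic R S S (fun i x => b i (a i x)) (fun=> id) ->
    (forall z z', ker_val z' = a 0 (ker_val z) ->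
      F1 (hclass _ _ z) = hclass _ _ z') ->
    (forall z z', ker_val z' = b 0 (ker_val z) ->
      G1 (hclass _ _ z) = hclass _ _ z') ->
    cancel F1 G1.
  move=> [l lE] F1E G1E q; have [z <-] := hclass_surj q.
  have [z' zz'] := cycle _ _ a z; rewrite (F1E _ _ zz').
  have [z'' zz''] := cycle _ _ b z'; rewrite (G1E _ _ zz'').
  apply/subr0_eq; rewrite -linearB; apply/hclass_eq0.
  (* In degree [-1 + 1] the homotopy term through the differential of a cycle vanishes, which leaves
     a boundary. *)
  exists (l (-1) (ker_val z)); have := lE (-1) (ker_val z).
  have := zz''; rewrite zz' /= => -> ->.
  by rewrite (ker_valP z : diff S (-1 + 1) (ker_val z) = 0) linear0 addr0.
apply/lmod_isoP; exists F, G; split.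
  by apply: back FE GE; exists h.
by apply: back GE FE; exists k.
Qed.

(** Exactness of [Hom(Y, X)] in degree [i + 1]. *)
Definition hom_exact (X : lmodType R) Y (i : int) : Prop :=
  forall u : {linear Y (i + 1) -> X}, (forall y, u (diff Y i y) = 0) ->
  exists v : {linear Y (i + 1 + 1) -> X}, forall y, v (diff Y (i + 1) y) = u y.

Lemma hom_exact_isoK (X : lmodType R) Y Z i :
  isoK Y Z -> hom_exact X Y i -> hom_exact X Z i.
Proof.
move=> [f [g [_ [h hE]]]] YX u ud.
have [|v vE] := YX (u \o f (i + 1)).
  by move=> y /=; rewrite -cmapE ud.
(* Since [u] kills boundaries, applying it to the homotopy from [f g] to the identity leaves only
   the correction [u h d]. *)
exists ((v \o g (i + 1 + 1)) \- (u \o h (i + 1))) => z /=.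
rewrite -cmapE vE /=; have /(congr1 u) := hE i z.
by rewrite linearB linearD ud add0r => <-; rewrite opprB addrC subrK.
Qed.

Lemma Kb_shift X : in_Kbproj X -> in_Kbproj (shift X).
Proof.
move=> [Xp [n Xn]]; split=> [i|]; first exact: Xp.
by exists n.+1 => i ni; apply: Xn; lia.
Qed.

Lemma is_zero_prod (M N : lmodType R) :
  is_zero M -> is_zero N -> is_zero (M * N)%type.
Proof. by move=> M0 N0 [x y]; rewrite [x]M0 [y]N0. Qed.

Lemma Kb_cone X Y (f : chain_map X Y) :
  in_Kbproj X -> in_Kbproj Y -> in_Kbproj (cone f).
Proof.
move=> [Xp [m Xm]] [Yp [n Yn]]; split=> [i|]; first exact: fg_proj_prod.
by exists (m + n).+1 => i ni; apply: is_zero_prod; [apply: Xm|apply: Yn]; lia.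
Qed.

Lemma Kb_csum X Y : in_Kbproj X -> in_Kbproj Y -> in_Kbproj (csum X Y).
Proof.
move=> [Xp [m Xm]] [Yp [n Yn]]; split=> [i|]; first exact: fg_proj_prod.
by exists (m + n)%N => i ni; apply: is_zero_prod; [apply: Xm|apply: Yn]; lia.
Qed.

(** These are the perfect complexes with no nonzero map, up to homotopy, to any shift of the stalk
    complex of [X]. *)
Lemma thick_hom_exact (X : lmodType R) :
  thick (fun Y => in_Kbproj Y /\ forall i, hom_exact X Y i).
Proof.
split=> [Y []|Y Z ZK YZ [_ YX]|Y [YK YX]|Y YK [_ YX]|Y Z f [YK YX] [ZK ZX]
  |Y Z YK ZK [_ YZX]] //.
- by split=> // i; apply: hom_exact_isoK YZ (YX i).
- split=> [|i u ud]; first exact: Kb_shift.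
  have [|v vE] := YX (i + 1) u.
    by move=> y; apply/eqP; rewrite -oppr_eq0 -linearN; apply/eqP/ud.
  by exists (\- v) => y; rewrite /= linearN opprK vE.
- split=> // i; rewrite -(subrK 1 i) => u ud.
  have [|v vE] := YX (i - 1) u.
    by move=> y; rewrite /= linearN ud oppr0.
  by exists (\- v) => y; rewrite /= -linearN; apply: vE.
- split=> [|i u ud]; first exact: Kb_cone.
  pose u1 : {linear Y (i + 1 + 1) -> X} := u \o lin_pair idfun \0.
  pose u2 : {linear Z (i + 1) -> X} := u \o lin_pair \0 idfun.
  have uE y z : u (y, z) = u1 y + u2 z.
    by rewrite /= -linearD /=; congr (u (_, _)); rewrite ?addr0 ?add0r.
  (* First extend on [Z]; what [v2] misses along [f] is killed by the differential of [Y], and so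
     extends as [v1]. *)
  have [|v2 v2E] := ZX i u2.
    move=> z; rewrite -[RHS](ud (0, z)) /=; congr (u (_, _)).
      by rewrite linear0 oppr0.
    by rewrite linear0 add0r.
  have [|v1 v1E] := YX (i + 1) (u1 \- (v2 \o f (i + 1 + 1))).
    move=> y; rewrite [LHS]/= -cmapE v2E.
    have : u (- diff Y (i + 1) y, f (i + 1) y + diff Z i 0) = 0 := ud (y, 0).
    rewrite uE linear0 addr0 linearN.
    by move/eqP; rewrite addrC subr_eq0 => /eqP ->; rewrite subrr.
  exists (lin_copair (\- v1) v2) => -[y z] /=.
  by rewrite uE linearN opprK v1E linearD v2E /= addrA subrK.
- split=> // i u ud.
  have [|v vE] := YZX i (u \o fst); first by move=> y; apply: ud.
  exists (v \o lin_pair idfun \0) => y; rewrite /= -[RHS](vE (y, 0)).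
  by congr (v (_, _)); rewrite /= linear0.
Qed.

End ChainMaps.

(** * Two-term complexes *)

Section TwoTerm.
Variable R : pzRingType.
Implicit Types P Q X Y Z : complex R.
Implicit Types A B N : lmodType R.

Lemma is_zero_rV0 : is_zero ('rV[R]_0 : lmodType R).
Proof. by move=> x; apply: thinmx0. Qed.

Section Build.
Variables (A B : lmodType R) (f : {linear A -> B}).

(** [Negz 0] is [-1]. Matching on constructors lets [-1 + 1] compute to 0, so that [f] itself can
    serve as the differential. *)
Definition tt_ob (i : int) : lmodType R :=
  match i with Posz 0 => B | Negz 0 => A | _ => 'rV[R]_0 end.

Definition tt_diff (i : int) : {linear tt_ob i -> tt_ob (i + 1)} :=
  match i as j return {linear tt_ob j -> tt_ob (j + 1)} with
  | Negz 0 => f | _ => \0 end.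

Fact tt_diffK i x : tt_diff (i + 1) (tt_diff i x) = 0.
Proof. by case: i x => [n|[|n]] x //=; rewrite linear0. Qed.

Definition tt : complex R := Complex tt_diffK.

Lemma tt_zero (i : int) : i != -1 -> i != 0 -> is_zero (tt i).
Proof. by case: i => [[|n]|[|n]] // _ _; apply: is_zero_rV0. Qed.

Lemma Kb_tt : fg_proj A -> fg_proj B -> in_Kbproj tt.
Proof.
move=> Ap Bp; split=> [[[|n]|[|n]]|]; try exact: fg_proj_rV; try by [].
by exists 1 => i ni; apply: tt_zero; lia.
Qed.

End Build.

Definition tt_map A B A' B' (a : {linear A -> A'}) (b : {linear B -> B'})
    (i : int) : {linear tt_ob A B i -> tt_ob A' B' i} :=
  match i with Posz 0 => b | Negz 0 => a | _ => \0 end.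

Lemma tt_map_comm A B A' B' (f : {linear A -> B}) (f' : {linear A' -> B'})
    (a : {linear A -> A'}) (b : {linear B -> B'}) :
  (forall x, f' (a x) = b (f x)) ->
  forall i x, diff (tt f') i (tt_map a b i x) =
    tt_map a b (i + 1) (diff (tt f) i x).
Proof.
by move=> fab [n|[|n]] x //=; rewrite linear0.
Qed.

Definition tt_chain A B A' B' (f : {linear A -> B}) (f' : {linear A' -> B'})
    (a : {linear A -> A'}) (b : {linear B -> B'})
    (fab : forall x, f' (a x) = b (f x)) : chain_map (tt f) (tt f') :=
  @ChainMap _ (tt f) (tt f') (tt_map a b) (tt_map_comm fab).

(** The sign bookkeeping of [model_presilting]. *)
Let homotopy_arith (V : zmodType) (wx wy p q r s m n : V) :
  wx = wy + (- p + q) -> - m + n - wx = r - s ->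
  wy = - (m - p + r) + (n - q + s).
Proof.
move=> -> /(congr1 (fun v => v + (wy + (- p + q)))); rewrite subrK => e.
rewrite [RHS](_ : _ = - m + n - (- p + q) - (r - s)); last first.
  by rewrite !opprD !opprK !addrA [LHS](ACl (1*4*2*5*3*6)).
by rewrite e [r - s + _]addrC addrAC addrK addrK.
Qed.

Section Model.
Variables P Q : complex R.
Hypothesis PQ : two_term_model P Q.

Let QK : in_Kbproj Q. Proof. by case: PQ. Qed.
Let Q0 (i : int) : i != -1 -> i != 0 -> is_zero (Q i).
Proof. by case: PQ => _ + _; apply. Qed.
Let iPQ : isoK P Q. Proof. by case: PQ. Qed.
Let d : {linear Q (-1) -> Q 0} := diff Q (-1).

Lemma model_coker : exists p : {linear Q 0 -> H0 Q}, coker d p.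
Proof. by apply: coker_homology => v; apply: (Q0 (i := 1)). Qed.

(** [Negz 1] is [-2], so exactness is asked in degree [-1], where the cocycle condition is automatic
    because [Q (-2)] is zero. *)
Lemma hom_exact_Tors (X : lmodType R) : hom_exact X Q (Negz 1) <-> Tors d X.
Proof.
split=> [QX u|dX u _]; last exact: dX.
by apply: QX => y; rewrite [y](Q0 (i := Negz 1)) // !linear0.
Qed.

(** Conjugating [w] by the equivalence gives a map from [P] to its shift. Its null-homotopy is
    carried back to [Q] and corrected by the homotopy [h] before and after [w]. *)
Lemma model_presilting : presilting P ->
  forall w : chain_map Q (shift Q), null_homotopic w.
Proof.
have [a [b [_ [h hE]]]] := iPQ; move=> [_ Ps] w.
have phiE i (x : P i) : diff (shift P) i (b (i + 1) (w i (a i x))) =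
    b (i + 1 + 1) (w (i + 1) (a (i + 1) (diff P i x))).
  by rewrite -!cmapE /= linearN -cmapE.
have [k kE] :=
  Ps 0 (@ChainMap _ P (shift P) (fun i => b (i + 1) \o w i \o a i) phiE).
exists (fun i => ((a (i + 1) \o k i \o b (i + 1)) \- (w i \o h i))
                 \+ (h (i + 1) \o w (i + 1) \o a (i + 1) \o b (i + 1))).
move=> i y; rewrite subr0.
pose x := a (i + 1) (b (i + 1) y).
have e1 : w (i + 1) x = w (i + 1) y
    + (- diff Q (i + 1) (w i (h i y)) +
       w (i + 1) (h (i + 1) (diff Q (i + 1) y))).
  rewrite -[- diff Q (i + 1) _]/(diff (shift Q) i (w i (h i y))) cmapE -linearD.
  by rewrite -hE linearB [RHS]addrC subrK.
have e2 := hE (i + 1) (w (i + 1) x).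
have dwx : diff Q (i + 1 + 1) (w (i + 1) x) = - w (i + 1 + 1)
    (a (i + 1 + 1) (b (i + 1 + 1) (diff Q (i + 1) y))).
  by rewrite -!cmapE /= opprK.
have e3 := congr1 (a (i + 1 + 1)) (kE i (b (i + 1) y)).
rewrite subr0 linearD /= linearN -cmapE (cmapE b) in e3.
rewrite e3 dwx [h _ (- _)]linearN in e2.
rewrite /= [diff Q (i + 1) (_ + _)]linearD linearB.
exact: homotopy_arith e1 e2.
Qed.

(** A map from [Q (-1)] to [N] lifts to [Q 0] and is then a chain map to the shift. The component of
    a null-homotopy on [Q 0], followed by [p], is the required extension. *)
Lemma self_map_Tors (N : lmodType R) (p : {linear Q 0 -> N}) : coker d p ->
  (forall w : chain_map Q (shift Q), null_homotopic w) -> Tors d N.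
Proof.
move=> dp Qs u; have [w wE] := (QK.1 (-1)).2 _ _ p u dp.1.
pose w' (i : int) : {linear Q i -> Q (i + 1)} :=
  match i with Negz 0 => w | _ => \0 end.
have w'E i (x : Q i) : diff (shift Q) i (w' i x) = w' (i + 1) (diff Q i x).
  have [i1|i1] := eqVneq i (-1); last have [i0|i0] := eqVneq i 0.
  - move: x; rewrite i1 => x.
    by rewrite [LHS](Q0 (i := 1)) // [RHS](Q0 (i := 1)).
  - move: x; rewrite i0 => x.
    by rewrite [LHS](Q0 (i := 2)) // [RHS](Q0 (i := 2)).
  - by rewrite [x]Q0 // !linear0.
have [k kE] := Qs (ChainMap w'E).
exists (p \o k (-1)) => x; rewrite -wE.
have /(congr1 p) := kE (Negz 1) x; rewrite subr0 /= => ->.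
have dd : p (diff Q (-1) (k (Negz 1) x)) = 0 by apply: (coker_comp dp).
by rewrite linearD linearN dd oppr0 add0r.
Qed.

Lemma two_term_presilting (N : lmodType R) (p : {linear Q 0 -> N}) :
  coker d p -> Tors d N -> presilting Q.
Proof.
move=> dp dN; split=> // n w.
have shift0 m (X : complex R) (i : int) : iter m (@shift R) X i = X (i + m%:Z).
  elim: m X i => [|m IH] X i; first by rewrite addr0.
  by rewrite /= IH -addrA.
(* A shift by two or more has no nonzero degree in common with [Q]. *)
case: n w => [|n] w; last first.
  exists (fun=> \0) => i x; rewrite subr0 /= linear0 oppr0 addr0 oppr0.
  have [|i0] := boolP ((i + 1 == -1) || (i + 1 == 0)); last first.
    by rewrite [x]Q0 ?linear0 //; lia.
  move=> i0; have tz : is_zero (iter n.+2 (@shift R) Q (i + 1)).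
    by rewrite shift0; apply: Q0; lia.
  exact: tz.
(* For the shift by one, [h0] makes [h0 d] agree with [w] modulo the image of [d], and [h1] lifts
   the difference. *)
have [v vE] := dN (p \o w (-1)).
have [h0 h0E] := (QK.1 0).2 _ _ p v dp.1.
pose w1 : {linear Q (-1) -> Q 0} := w (-1).
have [x|h1 h1E] :=
  projective_lift (u := (h0 \o d) \- w1) (c := d) (QK.1 (-1)).2.
  by apply/dp.2; rewrite linearB /= h0E vE subrr.
pose H (i : int) : {linear Q i -> Q i} :=
  match i with Negz 0 => h1 | Posz 0 => h0 | _ => \0 end.
exists (fun i => H (i + 1)) => i x; rewrite subr0 /=.
move: (i + 1) x => {}i x.
have [i1|i1] := eqVneq i (-1); last have [i0|i0] := eqVneq i 0.
- move: x; rewrite i1 => x; rewrite /= h1E /= opprB.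
  by rewrite -[LHS]/(w (-1) x) subrK.
- by move: x; rewrite i0 => x; rewrite [LHS](Q0 (i := 1)) // [RHS](Q0 (i := 1)).
- by rewrite [x]Q0 // !linear0 add0r.
Qed.

(** The two conditions on [X] give exactness of [Hom(Q, X)] in degrees [-1] and 0, and the other
    degrees are zero. Thickness spreads exactness to all perfect complexes. *)
Lemma model_silting (X : lmodType R) :
    silting P -> Tors d X ->
    (forall u : {linear Q 0 -> X},
      (forall a, u (d a) = 0) -> forall b, u b = 0) ->
  is_zero X.
Proof.
move=> [[PK _] Pgen] dX hX x.
have QX i : hom_exact X Q i.
  have [->|i2] := eqVneq i (Negz 1); first exact/hom_exact_Tors.
  have [->|i1] := eqVneq i (Negz 0).
    by move=> u ud; exists \0 => y; rewrite [RHS](hX u).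
  move=> u _; exists \0 => y; rewrite [y]Q0 ?linear0 //; lia.
have PX : in_Kbproj P /\ forall i, hom_exact X P i.
  by split=> // i; apply: hom_exact_isoK (isoK_sym iPQ) (QX i).
(* For [R] placed in degree [-1], exactness says that every map from [R] to [X] factors through
   zero. *)
have SK : in_Kbproj (tt (\0 : {linear R^o -> 'rV[R]_0})).
  by apply: Kb_tt; [apply: fg_proj_R|apply: fg_proj_rV].
have [_ /(_ (Negz 1) (lin_elt x))[|v vE]] := Pgen _ (thick_hom_exact X) PX _ SK.
  by move=> y; apply: linear0.
have := vE (1 : R^o); rewrite [X in v X](_ : _ = 0) // linear0.
by rewrite /= scale1r => <-.
Qed.

End Model.

(** Any two models are homotopy equivalent, and exactness of [Hom] is a homotopy invariant. *)
Lemma model_torsion P Q (X : lmodType R) :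
  two_term_model P Q -> torsion P X <-> Tors (diff Q (-1)) X.
Proof.
move=> PQ; split=> [[Q' [PQ' Q'X]]|QX]; last by exists Q.
have /(hom_exact_Tors PQ') Q'e : Tors (diff Q' (-1)) X by [].
apply/(hom_exact_Tors PQ); case: PQ PQ' => _ _ iPQ [_ _ iPQ'].
exact: hom_exact_isoK iPQ (hom_exact_isoK (isoK_sym iPQ') Q'e).
Qed.

End TwoTerm.

(** * Generation of the perfect complexes by one stalk *)

Section ThickGeneration.
Variable R : pzRingType.
Implicit Types P Q X Y Z : complex R.
Implicit Types A B M N : lmodType R.

(** A degreewise split short exact sequence of complexes is a triangle. *)
Lemma cone_split X Y Z (a : chain_map X Y) (p : chain_map Y Z)
    (r : forall i, {linear Y i -> X i}) (s : forall i, {linear Z i -> Y i}) :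
    (forall i, cancel (a i) (r i)) -> (forall i, cancel (s i) (p i)) ->
    (forall i y, a i (r i y) + s i (p i y) = y) ->
  isoK (cone a) Z.
Proof.
move=> raK psK arsp.
have spE i y : s i (p i y) = y - a i (r i y).
  by apply/esym/eqP; rewrite subr_eq addrC arsp.
have pa i x : p i (a i x) = 0 by rewrite -[LHS]psK spE raK subrr linear0.
have pE i (z : cone a i) :
    diff Z i (p i z.2) = p (i + 1) (diff (cone a) i z).2.
  by rewrite cmapE /= linearD pa add0r.
pose pp i : {linear cone a i -> Z i} := p i \o snd.
(* The component [- r d s] measures the failure of [s] to be a chain map and makes the section into
   the cone one. *)
pose ss i : {linear Z i -> cone a i} :=
  lin_pair (\- (r (i + 1) \o diff Y i \o s i)) (s i).
have sdE i z : s (i + 1) (diff Z i z) =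
    diff Y i (s i z) - a (i + 1) (r (i + 1) (diff Y i (s i z))).
  by rewrite -spE -cmapE psK.
have ssE i z : diff (cone a) i (ss i z) = ss (i + 1) (diff Z i z).
  rewrite /= /cone_diff_fun /= sdE.
  congr (_, _); last by rewrite linearN [LHS]addrC.
  rewrite linearN opprK [diff Y _ (_ - _)]linearB diffK sub0r cmapE.
  by rewrite [r _ (- _)]linearN raK opprK.
exists (@ChainMap _ (cone a) Z pp pE), (ChainMap ssE); split; last first.
  by exists (fun=> \0) => i z; rewrite /= psK subrr linear0 addr0.
exists (fun i => lin_pair (\- (r (i + 1) \o snd)) \0) => i [x y].
apply: injective_projections; rewrite /= spE; last first.
  by rewrite linear0 !addr0 linearN addrAC subrr add0r.
rewrite [diff Y _ (_ - _)]linearB [r _ (_ - _)]linearB [r _ (_ + _)]linearD.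
by rewrite [diff X _ (- _)]linearN cmapE !raK opprB opprK opprD addrA addrAC.
Qed.

Lemma csum_swap X Y : isoK (csum X Y) (csum Y X).
Proof.
pose f i : {linear csum X Y i -> csum Y X i} := lin_pair snd fst.
have fE i x : diff (csum Y X) i (f i x) = f (i + 1) (diff (csum X Y) i x) by [].
pose g i : {linear csum Y X i -> csum X Y i} := lin_pair snd fst.
by apply: (strict_isoK (f := ChainMap fE) (g := g)) => i [].
Qed.

(** Stalks and truncations are assembled degreewise from this switch, whose default is the zero
    module. *)
Definition sel (b : bool) M : lmodType R := if b then M else 'rV[R]_0.

Definition sel_in b M : {linear sel b M -> M} :=
  match b with true => idfun | false => \0 end.

Definition sel_pr b M : {linear M -> sel b M} :=
  match b with true => idfun | false => \0 end.

Lemma sel_prK b M (m : M) : sel_in b M (sel_pr b M m) = if b then m else 0.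
Proof. by case: b. Qed.

Lemma sel_inK b M (x : sel b M) : sel_pr b M (sel_in b M x) = x.
Proof. by case: b x => x //=; rewrite [RHS]thinmx0. Qed.

Lemma sel_false b M : ~~ b -> is_zero (sel b M).
Proof. by case: b => // _ x; apply: thinmx0. Qed.

Lemma sel_zero b M : is_zero M -> is_zero (sel b M).
Proof. by case: b => // _ x; apply: thinmx0. Qed.

Lemma sel_fg_proj b M : fg_proj M -> fg_proj (sel b M).
Proof. by case: b => // _; apply: fg_proj_rV. Qed.

Section Truncation.
Variables (X : complex R) (c : int -> bool).

Definition trunc_diff (i : int) :
    {linear sel (c i) (X i) -> sel (c (i + 1)) (X (i + 1))} :=
  sel_pr (c (i + 1)) (X (i + 1)) \o diff X i \o sel_in (c i) (X i).

Fact trunc_diffK i x : trunc_diff (i + 1) (trunc_diff i x) = 0.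
Proof.
rewrite /= sel_prK; case: (c (i + 1)); last by rewrite !linear0.
by rewrite diffK linear0.
Qed.

Definition trunc : complex R := Complex trunc_diffK.

Lemma Kb_trunc : in_Kbproj X -> in_Kbproj trunc.
Proof.
move=> [Xp [n Xn]]; split=> [i|]; first exact: sel_fg_proj.
by exists n => i ni; apply/sel_zero/Xn.
Qed.

End Truncation.

(** The shift of [X] is the cone of the map from [trunc X c] to the shift of the
    complementary truncation that is induced by the differential. *)
Lemma thick_trunc (C : complex R -> Prop) X (c : int -> bool) :
    thick C -> in_Kbproj X -> (forall i, c (i + 1) -> c i) ->
    C (trunc X c) -> C (trunc X (predC c)) ->
  C X.
Proof.
move=> Cth XK cd CX CX'; apply: (thick_unshift Cth) => //.
set T := trunc X c; set T' := trunc X (predC c).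
pose phi i : {linear T i -> shift T' i} :=
  \- (sel_pr (predC c (i + 1)) (X (i + 1)) \o diff X i \o sel_in (c i) (X i)).
have sel_split i (x : X i) :
    sel_in (c i) (X i) (sel_pr (c i) (X i) x) +
    sel_in (predC c i) (X i) (sel_pr (predC c i) (X i) x) = x.
  by rewrite !sel_prK /=; case: (c i); rewrite ?addr0 ?add0r.
have phiE i x : diff (shift T') i (phi i x) = phi (i + 1) (diff T i x).
  apply/eqP; rewrite -subr_eq0 /= !linearN !opprK -!linearD /=.
  by rewrite [sel_in _ _ _ + _]addrC sel_split diffK linear0.
pose F i : {linear shift X i -> cone (ChainMap phiE) i} :=
  lin_pair (sel_pr (c (i + 1)) (X (i + 1)))
           (sel_pr (predC c (i + 1)) (X (i + 1))).
pose G i : {linear cone (ChainMap phiE) i -> shift X i} :=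
  lin_copair (sel_in (c (i + 1)) (X (i + 1)))
             (sel_in (predC c (i + 1)) (X (i + 1))).
have FE i x : diff (cone (ChainMap phiE)) i (F i x) =
    F (i + 1) (diff (shift X) i x).
  rewrite /= /cone_diff_fun /= !linearN; congr (_, _).
    rewrite -[X in _ = - sel_pr _ _ (diff _ _ X)]sel_split !linearD /=.
    (* By [cd] the differential has no component from the complement into the part selected by
       [c]. *)
    rewrite [X in _ = _ - X](_ : _ = 0) ?subr0 // sel_prK /=.
    case cc: (c (i + 1)); first by rewrite !linear0.
    by apply: sel_false; apply: contraFN cc => /cd.
  by rewrite -[X in _ = - sel_pr _ _ (diff _ _ X)]sel_split !linearD.
have FK i : cancel (F i) (G i) by move=> x; apply: sel_split.
have GK i : cancel (G i) (F i).
  move=> [x y]; rewrite /= !linearD /= !sel_inK.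
  have -> : sel_pr (c (i + 1)) (X (i + 1))
      (sel_in (predC c (i + 1)) (X (i + 1)) y) = 0.
    by move: y => /=; case: (c _) => y; rewrite ?linear0.
  have -> : sel_pr (predC c (i + 1)) (X (i + 1))
      (sel_in (c (i + 1)) (X (i + 1)) x) = 0.
    by move: x => /=; case: (c _) => x; rewrite ?linear0.
  by rewrite addr0 add0r.
have XT := strict_isoK (f := ChainMap FE) FK GK.
apply: (thick_iso Cth (Kb_shift XK) (isoK_sym XT)).
by apply: thick_cone => //; apply: thick_shift.
Qed.

(** A property rather than a chosen complex, so that shifts, sums and truncations qualify without
    transport between equal degrees. *)
Definition concentrated (k : int) M Y : Prop :=
  (forall i, i != k -> is_zero (Y i)) /\ lmod_iso (Y k) M.

Lemma concentrated_isoK k M Y Z :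
  concentrated k M Y -> concentrated k M Z -> isoK Y Z.
Proof.
move=> [Y0 YM] [Z0 ZM].
have YZ i : {f : {linear Y i -> Z i} & {g : {linear Z i -> Y i} |
    cancel f g /\ cancel g f}}.
  suff /lmod_isoP/cid[f /cid[g fg]] : lmod_iso (Y i) (Z i) by exists f, g.
  have [->|ik] := eqVneq i k; first exact: lmod_iso_trans YM (lmod_iso_sym ZM).
  by apply: is_zero_retract; [apply: Y0|apply: Z0].
have fE i (y : Y i) : diff Z i (projT1 (YZ i) y) =
    projT1 (YZ (i + 1)) (diff Y i y).
  have [ik|ik] := eqVneq i k; last by rewrite [y]Y0 // !linear0.
  by apply: etrans (esym _); apply: Z0; rewrite ik; lia.
pose g i := projT1 (projT2 (YZ i)).
apply: (strict_isoK (f := ChainMap fE) (g := g)) => i.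
  exact: (projT2 (projT2 (YZ i))).1.
exact: (projT2 (projT2 (YZ i))).2.
Qed.

Lemma concentrated_Kb k M Y : fg_proj M -> concentrated k M Y -> in_Kbproj Y.
Proof.
move=> Mp [Y0 YM]; split=> [i|].
  have [->|ik] := eqVneq i k; first exact: fg_proj_iso (lmod_iso_sym YM) Mp.
  exact/fg_proj_zero/Y0.
by exists `|k|%N => i ki; apply: Y0; lia.
Qed.

Lemma stalk_exists k M : exists Y, concentrated k M Y.
Proof.
pose d i : {linear sel (i == k) M -> sel (i + 1 == k) M} := \0.
have dK i x : d (i + 1) (d i x) = 0 by [].
exists (Complex dK); split=> [i ik|/=]; first exact: sel_false.
by rewrite eqxx; exists idfun; exists idfun.
Qed.

Lemma concentrated_shift k M Y :
  concentrated (k + 1) M Y -> concentrated k M (shift Y).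
Proof. by move=> [Y0 YM]; split=> // i ik; apply: Y0; lia. Qed.

Lemma concentrated_csum k M N Y Z :
  concentrated k M Y -> concentrated k N Z ->
  concentrated k (M * N)%type (csum Y Z).
Proof.
move=> [Y0 /lmod_isoP[f [g [fK gK]]]] [Z0 /lmod_isoP[f' [g' [fK' gK']]]].
split=> [i ik|]; first by apply: is_zero_prod; [apply: Y0|apply: Z0].
apply/lmod_isoP; exists (lin_pair (f \o fst) (f' \o snd)).
exists (lin_pair (g \o fst) (g' \o snd)).
by split=> -[x y] /=; rewrite ?fK ?fK' ?gK ?gK'.
Qed.

Section Thick.
Variables (C : complex R -> Prop) (Cth : thick C).

Let stalks M := forall k Y, concentrated k M Y -> C Y.

Let stalksP M : fg_proj M -> (forall k, exists2 Y, concentrated k M Y & C Y) ->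
  stalks M.
Proof.
move=> Mp MC k Y YM; have [Z ZM CZ] := MC k.
exact: (thick_iso Cth (concentrated_Kb Mp YM) (concentrated_isoK ZM YM) CZ).
Qed.

(** Shifts in both directions reach every degree, by induction on the distance from [k0]. *)
Lemma thick_stalks_all_degrees k0 M Y0 :
  fg_proj M -> concentrated k0 M Y0 -> C Y0 -> stalks M.
Proof.
move=> Mp Y0M CY0; pose T k := forall Y, concentrated k M Y -> C Y.
have Tup k : T k -> T (k + 1).
  move=> Tk Y YM; apply: (thick_unshift Cth); first exact: concentrated_Kb YM.
  exact/Tk/concentrated_shift.
have Tdown k : T (k + 1) -> T k.
  move=> Tk Y YM; have [Z ZM] := stalk_exists (k + 1) M.
  have ZY := concentrated_isoK (concentrated_shift ZM) YM.
  apply: (thick_iso Cth (concentrated_Kb Mp YM) ZY).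
  exact/(thick_shift Cth)/Tk.
have Tk0 : T k0.
  move=> Y YM; have Y0Y := concentrated_isoK Y0M YM.
  exact: (thick_iso Cth (concentrated_Kb Mp YM) Y0Y CY0).
have Tn (n : nat) : T (k0 + n%:Z) /\ T (k0 - n%:Z).
  elim: n => [|n [IHu IHd]]; first by rewrite (_ : k0 - _ = k0) ?addr0 //; lia.
  split; first by rewrite (_ : k0 + _ = k0 + n%:Z + 1); [apply: Tup|lia].
  by apply: Tdown; rewrite (_ : _ + 1 = k0 - n%:Z) //; lia.
move=> k; have [kk|kk] : (k0 <= k) \/ (k < k0) by lia.
  by have := (Tn `|k - k0|%N).1; rewrite (_ : k0 + _ = k) //; lia.
by have := (Tn `|k0 - k|%N).2; rewrite (_ : k0 - _ = k) //; lia.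
Qed.

Let stalks_summand M N :
  fg_proj M -> fg_proj N -> stalks (M * N)%type -> stalks M.
Proof.
move=> Mp Np MN k Y YM; have [Z ZN] := stalk_exists k N.
apply: (thick_summand Cth (concentrated_Kb Mp YM) (concentrated_Kb Np ZN)).
exact: MN (concentrated_csum YM ZN).
Qed.

Let stalks_iso M N : lmod_iso M N -> stalks M -> stalks N.
Proof.
move=> MN SM k Y [Y0 YN]; apply: (SM k); split=> //.
exact: lmod_iso_trans YN (lmod_iso_sym MN).
Qed.

Let stalks_prod M N : fg_proj M -> fg_proj N -> stalks M -> stalks N ->
  stalks (M * N)%type.
Proof.
move=> Mp Np SM SN; apply: stalksP => [|k]; first exact: fg_proj_prod.
have [Y YM] := stalk_exists (k + 1) M; have [Z ZN] := stalk_exists k N.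
have zE i (y : Y i) : diff Z i ((fun i => \0 : {linear Y i -> Z i}) i y) =
    (fun i => \0 : {linear Y i -> Z i}) (i + 1) (diff Y i y) by apply: linear0.
(* The cone of the zero map has the modules of the direct sum, and moves [M] from degree [k + 1] to
   [k]. *)
exists (cone (ChainMap zE)).
  have := concentrated_csum (concentrated_shift YM) ZN.
  by move=> [Y0 YN]; split.
by apply: thick_cone => //; [apply: SM YM|apply: SN ZN].
Qed.

(** From [R] one reaches finite free modules, then their summands as stalks, then bounded complexes
    by cutting off one degree at a time. *)
Lemma thick_generation k0 Y0 :
  concentrated k0 R^o Y0 -> C Y0 -> forall X, in_Kbproj X -> C X.
Proof.
move=> Y0R CY0.
have SR : stalks R^o := thick_stalks_all_degrees (fg_proj_R R) Y0R CY0.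
have S0 M : is_zero M -> stalks M.
  move=> M0; apply: (@stalks_summand M R^o).
  - exact: fg_proj_zero.
  - exact: fg_proj_R.
  apply: stalks_iso SR; apply/lmod_isoP; exists (lin_pair \0 idfun), snd.
  by split=> // -[x y] /=; rewrite [x]M0.
have SV n : stalks 'rV[R]_n.
  elim: n => [|n IH]; first exact/S0/is_zero_rV0.
  apply: (@stalks_iso (R^o * 'rV[R]_n)%type); last first.
    by apply: stalks_prod => //; [apply: fg_proj_R|apply: fg_proj_rV].
  have cl : linear (fun x : R^o => \row_(j < 1) x : 'rV[R]_1).
    by move=> a x y; apply/rowP=> j; rewrite !mxE.
  have el : linear (fun x : 'rV[R]_1 => x 0 0 : R^o).
    by move=> a x y; rewrite !mxE.
  have rl : linear (fun x : 'rV[R]_1 * 'rV[R]_n =>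
      row_mx x.1 x.2 : 'rV[R]_n.+1).
    by move=> a x y; rewrite /= -add_row_mx -scale_row_mx.
  apply/lmod_isoP; exists (mklin rl \o lin_pair (mklin cl \o fst) snd).
  exists (lin_pair (mklin el \o (@lsubmx R 1 1 n)) (@rsubmx R 1 1 n)).
  split=> [[x y]|x] /=; first by rewrite row_mxKl row_mxKr mxE.
  apply: etrans (@hsubmxK _ 1 1 n x); congr (row_mx _ _).
  by apply/rowP=> j; rewrite mxE ord1.
have SP M : fg_proj M -> stalks M.
  move=> [[n [p ps]] Mp]; have [s sE] := Mp _ _ p idfun ps.
  have Mi := retract_iso sE.
  apply: (stalks_summand (N := ker p)); last exact: stalks_iso Mi (SV n).
    by split=> //; exists n, p.
  apply: fg_proj_retract (fg_proj_rV R n); apply/summand_retract.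
  exists M; apply: lmod_iso_trans Mi _; apply/lmod_isoP.
  by exists (lin_pair snd fst), (lin_pair snd fst); split=> -[].
(* Induction on the length [m] of a window of degrees, starting at [a], outside which [X]
   vanishes. *)
have all m : forall (a : int) X, in_Kbproj X ->
    (forall i, (i < a) || (a + m%:Z <= i) -> is_zero (X i)) -> C X.
  elim: m => [|m IH] a X XK X0.
    have Xz i : is_zero (X i) by apply: X0; lia.
    apply: (S0 (X 0) (Xz 0) 0); split=> //.
    by exists idfun; exists idfun.
  (* The top degree [a + m] is split off as a stalk, and the rest has a window of length [m]. *)
  apply: (@thick_trunc _ X (fun i => i < a + m%:Z)) => // [i||]; first by lia.
    apply: (IH a); first exact: Kb_trunc.
    move=> i /orP[ia|ia]; last by apply: sel_false; lia.
    by apply/sel_zero/X0; rewrite ia.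
  apply: (SP (X (a + m%:Z)) (XK.1 _) (a + m%:Z)); split=> [i ia|/=].
    have [ai|ai] := boolP (i < a + m%:Z); first by apply: sel_false => /=; lia.
    by apply/sel_zero/X0; lia.
  have -> : (a + m%:Z < a + m%:Z) = false by lia.
  by exists idfun; exists idfun.
move=> X XK; have [_ [n Xn]] := XK.
(* The degrees from [-n] to [n] form a window of length [2n + 1]. *)
by apply: (all (n + n).+1 (- n%:Z) X XK) => i ni; apply: Xn; lia.
Qed.

End Thick.
End ThickGeneration.

(** * Silting *)

Section TraceQuotient.
Variables (R : pzRingType) (N X : lmodType R).

Definition trace_pred : {pred X} := fun x => `[< trace N x >].

Fact trace_submod_closed : submod_closed trace_pred.
Proof.
split=> [|a x y /asboolP xN /asboolP yN]; apply/asboolP; first exact: trace0.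
by apply: traceD => //; apply: traceZ.
Qed.

HB.instance Definition _ :=
  GRing.isSubmodClosed.Build R X trace_pred trace_submod_closed.

Definition trace_quot : {linear X -> lmod_quot trace_pred} :=
  lin_quot trace_pred.

Lemma trace_quot_surj : surjective trace_quot.
Proof. exact: lin_quot_surj. Qed.

Lemma trace_quot_eq0 x : trace_quot x = 0 <-> trace N x.
Proof.
by split=> [/lin_quot_eq0/asboolP|H]; last exact/lin_quot_eq0/asboolP.
Qed.

End TraceQuotient.

Section Torsion.
Variable R : pzRingType.
Implicit Types A B L N X : lmodType R.

(** [X] modulo its trace [tX] again lies in [Tors f], and receives no nonzero
    map from [N]: such a map lifts to [X], as [tX] lies in [Tors f] too. *)
Lemma Tors_trace A B N (f : {linear A -> B}) (p : {linear B -> N}) :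
    fg_proj A -> fg_proj B -> coker f p -> Tors f N ->
    (forall X, Tors f X ->
      (forall u : {linear B -> X},
        (forall a, u (f a) = 0) -> forall b, u b = 0) ->
      is_zero X) ->
  forall X, Tors f X -> generated_by N X.
Proof.
move=> Ap Bp fp fN fzero X fX x; apply/trace_quot_eq0.
apply: fzero => [|u uf b].
  exact: Tors_quotient Ap.2 (@trace_quot_surj _ N X) fX.
have [w wE] := Bp.2 _ _ _ u (@trace_quot_surj _ N X).
have [a|L [c [k [NL ckE]]]] := @trace_lift _ N _ _ (w \o f) Ap.
  by apply/trace_quot_eq0; rewrite wE.
have [v vE] := Tors_add fN NL k.
have [a|g gE] := coker_lift fp (u := w \- (c \o v)).
  by rewrite /= vE ckE subrr.
rewrite -wE; apply/trace_quot_eq0; rewrite -[w b](subrK (c (v b))).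
apply: traceD; last by exists L, c, (v b).
by rewrite -[_ - _]gE; apply: trace_hom.
Qed.

Lemma universal_elt_ffun (I : finType) N L (z : L) :
  universal_elt N z -> universal_elt {ffun I -> N} z.
Proof.
move=> zN m; have [g gE] := choice (fun i => zN (m i)).
by exists (lin_tuple g); apply/ffunP=> i; rewrite ffunE gE.
Qed.

Lemma in_add_of_ffun (I : finType) N : (0 < #|I|)%N -> in_add {ffun I -> N} N.
Proof.
move=> /card_gt0P[i _]; apply: in_add_retract (in_add_refl _).
by exists (lin_inj N i), (lin_coord N i) => x; rewrite /= ffunE eqxx.
Qed.

(** The common input for the approximation sequence in (ii) and for the silting complex in (i). *)
Record approximating_presentation A B N X (f : {linear A -> B})
    (p : {linear B -> N}) (z : N) (t : {linear N -> X}) : Prop := {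
  ap_A : fg_proj A;
  ap_B : fg_proj B;
  ap_coker : coker f p;
  ap_Tors : forall Y, Tors f Y <-> generated_by N Y;
  ap_universal : universal_elt N z;
  ap_quotient : coker (lin_elt z) t;
  ap_add : in_add N X }.

(** Passing to a nonempty power of [f] puts the universal element in the cokernel itself, and
    changes neither [Tors] nor [add]. *)
Lemma approximating_presentation_exists A B N (f : {linear A -> B})
    (p : {linear B -> N}) :
    fg_proj A -> fg_proj B -> coker f p ->
    (forall X, Tors f X <-> generated_by N X) ->
  exists A' B' N' X (f' : {linear A' -> B'}) (p' : {linear B' -> N'}) z
      (t : {linear N' -> X}),
    add_eq N N' /\ approximating_presentation f' p' z t.
Proof.
move=> Ap Bp fp fN; have [I [z [I0 zN]]] := universal_elt_exists fN.
have NN' : add_eq N {ffun I -> N}.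
  by apply/add_eqP; split; [apply: in_add_of_ffun|apply: in_add_ffun].
have fN' Y : Tors (lin_map I f) Y <-> generated_by {ffun I -> N} Y.
  have [N'N NinN'] := (add_eqP _ _).1 NN'.
  split=> [/Tors_ffun_map-/(_ I0)/fN|/(generated_add NinN')/fN].
    exact: generated_add.
  exact: Tors_map_ffun.
(* The quotient by [z] is obtained as the homology of [lin_elt z] followed by a zero map. *)
have [t zt] := @coker_homology R _ _ ('rV[R]_0) (lin_elt z) \0 (fun=> erefl).
have fp' := coker_ffun I fp.
exists {ffun I -> A}, {ffun I -> B}, {ffun I -> N}, _,
  (lin_map I f), (lin_map I p), z, t.
split=> //; split; try exact: fg_proj_ffun; try by [].
  exact: universal_elt_ffun.
apply: (quotient_universal_in_add fp') zt => //; try exact: fg_proj_ffun.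
exact: universal_elt_ffun.
Qed.

End Torsion.

(** * Silting complexes from a presentation and its extension *)

Section Extension.
Variable R : pzRingType.
Implicit Types (P Q : complex R) (A B M N X : lmodType R).

Section Sum.
Variables (A B A' B' : lmodType R).
Variables (f : {linear A -> B}) (f' : {linear A' -> B'}).
Hypotheses (Ap : fg_proj A) (Bp : fg_proj B).
Hypotheses (Ap' : fg_proj A') (Bp' : fg_proj B').
Let S := csum (tt f) (tt f').

Lemma tt_sum_model : two_term_model S S.
Proof.
split=> [|i i1 i0|]; last exact: isoK_refl.
  by apply: Kb_csum; apply: Kb_tt.
by apply: is_zero_prod; apply: tt_zero.
Qed.

Lemma tt_sum_two_term : two_term S.
Proof. by split; [case: tt_sum_model|exists S; apply: tt_sum_model]. Qed.

Lemma tt_sum_torsion X : torsion S X <-> Tors f X /\ Tors f' X.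
Proof. by rewrite (model_torsion X tt_sum_model); apply: Tors_sum. Qed.

Section Coker.
Variables (N N' : lmodType R) (p : {linear B -> N}) (p' : {linear B' -> N'}).
Hypotheses (fp : coker f p) (fp' : coker f' p').

Lemma tt_sum_H0 : lmod_iso (H0 S) (N * N')%type.
Proof.
have [q Sq] := model_coker tt_sum_model.
exact: coker_iso Sq (coker_sum fp fp').
Qed.

Lemma tt_sum_presilting :
  Tors f (N * N')%type -> Tors f' (N * N')%type -> presilting S.
Proof.
move=> fN f'N; apply: (two_term_presilting tt_sum_model (coker_sum fp fp')).
by apply/(Tors_sum f f').
Qed.

End Coker.
End Sum.

(** [R] sits in a triangle [R -> (f) -> (q) -> R[1]]. *)
Lemma thick_extend (C : complex R -> Prop) A B (f : {linear A -> B}) (b : B) :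
    fg_proj A -> fg_proj B -> thick C ->
    C (csum (tt f) (tt (lin_copair f (lin_elt b)))) ->
  forall Y : complex R, in_Kbproj Y -> C Y.
Proof.
move=> Ap Bp Cth CS; set q := lin_copair f (lin_elt b) in CS *.
have fK : in_Kbproj (tt f) by apply: Kb_tt.
have qK : in_Kbproj (tt q).
  by apply: Kb_tt => //; apply: fg_proj_prod (fg_proj_R R).
have Cf : C (tt f) by apply: thick_summand CS.
have Cq : C (tt q).
  apply: (thick_summand Cth qK fK).
  exact: (thick_iso Cth (Kb_csum qK fK) (csum_swap _ _) CS).
(* The chain map from [f] to [q] is the inclusion on [A] and the identity on [B]; its degreewise
   complement is [R] in degree [-1]. *)
pose ax : {linear A -> (A * R^o)%type} := lin_pair idfun \0.
have aE x : q (ax x) = (idfun : {linear B -> B}) (f x).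
  by rewrite /= scale0r addr0.
pose o : {linear R^o -> 'rV[R]_0} := \0.
pose px : {linear (A * R^o)%type -> R^o} := snd.
have pE x : o (px x) = (\0 : {linear B -> 'rV[R]_0}) (q x) by [].
have oR : concentrated (-1) R^o (tt o).
  split=> [i i1|]; last by exists idfun; exists idfun.
  have [->|i0] := eqVneq i 0; first exact: is_zero_rV0.
  exact: tt_zero.
apply: (thick_generation Cth oR).
apply: (thick_iso Cth (X := cone (tt_chain aE))).
- by apply: Kb_tt; [apply: fg_proj_R|apply: fg_proj_rV].
- apply: (@cone_split _ _ _ _ (tt_chain aE) (tt_chain pE)
    (tt_map fst idfun) (tt_map (lin_pair \0 idfun) \0)).
  + by move=> [[|n]|[|n]] x //=; apply: esym; apply: thinmx0.
  + by move=> [[|n]|[|n]] x //=; apply: esym; apply: thinmx0.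
  + move=> [[|n]|[|n]] x /=; rewrite ?addr0 //.
    * by apply: esym; apply: thinmx0.
    * by case: x => x r; congr (_, _); rewrite /= ?addr0 ?add0r.
    * by apply: esym; apply: thinmx0.
- exact: thick_cone.
Qed.

(** The sum of [f] and its extension has [H^0] equal to [N * X], which is generated by [N]. It thus
    lies in [Tors f], and in the class of the extension by universality of [z]. *)
Lemma approximating_presentation_silting A B N X (f : {linear A -> B})
    (p : {linear B -> N}) (z : N) (t : {linear N -> X}) :
    approximating_presentation f p z t ->
  exists P, two_silt P /\ add_eq (H0 P) N.
Proof.
move=> [Ap Bp fp fN zN zt NX]; have [b pb] := fp.1 z.
have ARp : fg_proj (A * R^o)%type := fg_proj_prod Ap (fg_proj_R R).
have fq := coker_extend fp pb zt.
exists (csum (tt f) (tt (lin_copair f (lin_elt b)))); split.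
  have NNX : generated_by N (N * X)%type.
    by apply/in_add_generated/in_add_prod => //; apply: in_add_refl.
  split; first exact: tt_sum_two_term.
  split=> [|C Cth CS]; last exact: thick_extend CS.
  apply: (tt_sum_presilting _ _ _ _ fp fq) => //; first exact/fN.
  apply: (Tors_extend fp pb) => [|y]; first exact/fN.
  exact: universal_trace zN (NNX y).
apply: (add_eq_trans (lmod_iso_add_eq (tt_sum_H0 Ap Bp ARp Bp fp fq))).
apply/add_eqP; split; first by apply: in_add_prod NX; apply: in_add_refl.
apply: in_add_retract (in_add_refl _).
by exists (lin_pair idfun \0), fst.
Qed.

Lemma approximating_presentation_approx A B M N X (f : {linear A -> B})
    (p : {linear B -> N}) (z : N) (t : {linear N -> X}) :
    approximating_presentation f p z t -> add_eq N M ->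
  has_approx_seq M (generated_by M).
Proof.
move=> [Ap Bp fp fN zN zt NX] /add_eqP[MN NM].
exists N, X, (lin_elt z), t; split; [exact: zt.2|exact: zt.1| |by []|].
  split; first exact: in_add_generated.
  move=> Y h MY; have [k kE] := universal_trace zN (generated_add NM MY (h 1)).
  by exists k => r; rewrite /= linearZ kE [RHS]lin_eltE.
exact: in_add_trans NX.
Qed.

(** As [M0] lies in [add M], an approximation survives the passage to a smaller class that still
    contains [add M]. *)
Lemma approx_seq_sub M (C C' : lmodType R -> Prop) :
    (forall X, in_add M X -> C' X) -> (forall X, C' X -> C X) ->
  has_approx_seq M C -> has_approx_seq M C'.
Proof.
move=> addC' C'C [M0 [M1 [g [p [gp ps [_ gC] addM0 addM1]]]]].
exists M0, M1, g, p; split=> //; split; first exact: addC'.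
by move=> Y h /C'C; apply: gC.
Qed.

Lemma approx_seq_torsion A B M N (f : {linear A -> B}) (p : {linear B -> N}) :
    fg_proj A -> fg_proj B -> coker f p -> Tors f N -> add_eq N M ->
    has_approx_seq M (in_add M) ->
  exists P, [/\ two_term P, add_eq (H0 P) M
    & forall X, torsion P X <-> generated_by M X].
Proof.
move=> Ap Bp fp fN /add_eqP[MN NM] [M0 [M1 [g [t [gt ts [_ gM] M0M M1M]]]]].
have [n /summand_retract[i [r irK]]] := in_add_trans NM M0M.
(* [M0] is only a summand of a power of [N]. The approximation is prolonged into the whole power, at
   the cost of adding [ker r] to the cokernel. *)
pose z : {ffun 'I_n -> N} := i (g 1).
have gE s : g s = (s : R) *: g 1 by apply: lin_eltE.
have [w wE] : exists w : {linear {ffun 'I_n -> N} -> ker r},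
    forall x, ker_val (w x) = x - i (r x).
  apply: (@ker_lift R _ _ r _ (idfun \- (i \o r))) => x /=.
  by rewrite linearB irK subrr.
have zt : coker (lin_elt z) (lin_pair (t \o r) w).
  split=> [[x k]|y].
    have [m tm] := ts x; exists (i m + ker_val k).
    have rk : r (i m + ker_val k) = m by rewrite linearD irK ker_valP addr0.
    congr (_, _); first by rewrite /= rk.
    by apply: val_inj; rewrite /= wE rk addrC addKr.
  split=> [[tr0 w0]|[s <-]].
    have [s gs] := (gt (r y)).1 tr0; exists s.
    have : ker_val (w y) = 0 by rewrite w0.
    rewrite wE => /subr0_eq ->; rewrite -gs gE.
    by rewrite /= /z linearZ.
  congr (_, _); rewrite /= linearZ.
    by rewrite /z irK; apply/gt; exists s; apply: gE.
  have -> : w z = 0 by apply: val_inj; rewrite /= wE /z irK subrr.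
  exact: scaler0.
have zN : universal_elt N z.
  move=> m; have [k kE] := gM N (lin_elt m) MN.
  exists (k \o r); rewrite /= /z irK kE /=; exact: scale1r.
have fp' := coker_ffun 'I_n fp; have [b pb] := fp'.1 z.
have A'p := fg_proj_ffun 'I_n Ap; have B'p := fg_proj_ffun 'I_n Bp.
have ARp := fg_proj_prod A'p (fg_proj_R R).
have fq := coker_extend fp' pb zt.
have qN : Tors (lin_copair (lin_map 'I_n f) (lin_elt b)) N.
  by apply: (Tors_extend fp' pb) => //; apply: Tors_map_ffun.
(* The summand [f] keeps [N] itself among the summands of [H^0]. *)
exists (csum (tt f) (tt (lin_copair (lin_map 'I_n f) (lin_elt b)))); split.
- exact: tt_sum_two_term.
- apply: (add_eq_trans (lmod_iso_add_eq (tt_sum_H0 Ap Bp ARp B'p fp fq))).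
  apply/add_eqP; split; last first.
    apply: in_add_trans NM; apply: in_add_retract (in_add_refl _).
    by exists (lin_pair idfun \0), fst.
  apply: in_add_prod => //; apply: in_add_prod => //.
  apply: in_add_trans MN _; exists n; apply/summand_retract.
  exists (ker_incl r), w => k; apply: val_inj.
  by rewrite /= wE ker_valP linear0 subr0.
- move=> X; rewrite (tt_sum_torsion _ _ Ap Bp ARp B'p); split=> [[fX qX] x|MX].
    have [h <-] := Tors_extend_universal fp' pb qX x.
    apply: trace_add MN _; exists _, h, z; split=> //; exact: in_add_ffun.
  have NX := generated_add NM MX.
  by split; [apply: Tors_generated NX|apply: Tors_generated NX].
Qed.

End Extension.

(** * The cycle of implications *)

Theorem theoremA3 (R : pzRingType) (M : lmodType R)
    (M_fp : finitely_presented M) :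
  [<-> (* i *) silting_module M;
       (* ii *) exists P : complex R, [/\ two_psilt P, add_eq (H0 P) M
                  & has_approx_seq M (torsion P)];
       (* iii *) exists P : complex R, [/\ two_psilt P, add_eq (H0 P) M
                  & has_approx_seq M (in_Gen M)];
       (* iv *) exists P : complex R, [/\ two_psilt P, add_eq (H0 P) M
                  & has_approx_seq M (in_add M)];
       (* v *) exists P : complex R, [/\ two_term P, add_eq (H0 P) M
                  & forall X : lmodType R, torsion P X <-> in_Gen M X]].
Proof.
(* Each complex is traded for a map [f] with cokernel [N], together with what presilting and silting
   say about [Tors f]. *)
have model P : two_term P -> add_eq (H0 P) M ->
    exists (A B N : lmodType R) (f : {linear A -> B}) (p : {linear B -> N}),
    [/\ fg_proj A, fg_proj B, coker f p & add_eq N M] /\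
    [/\ forall X, torsion P X <-> Tors f X,
        presilting P -> Tors f N
      & silting P -> forall X, Tors f X -> generated_by N X].
  move=> [_ [Q PQ]] PM; have [p dp] := model_coker PQ.
  have [QK _ iPQ] := PQ.
  exists (Q (-1)), (Q 0), (H0 Q), (diff Q (-1)), p; split.
    split=> //; try exact: QK.1.
    exact: add_eq_trans (add_eq_sym (lmod_iso_add_eq (isoK_H0 iPQ))) PM.
  have dN : presilting P -> Tors (diff Q (-1)) (H0 Q).
    by move=> /(model_presilting PQ); apply: (self_map_Tors PQ dp).
  split=> // [X|Ps X dX]; first exact: model_torsion.
  apply: (Tors_trace _ _ dp) dX => //; try exact: QK.1.
    by apply: dN; case: Ps.
  by move=> Y dY; apply: (model_silting PQ).
have torsion_Gen P : presilting P -> two_term P -> add_eq (H0 P) M ->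
    forall X, in_Gen M X -> torsion P X.
  move=> Ps P2 PM X.
  have [A [B [N [f [p [[Ap Bp fp NM] [PX fN _]]]]]]] := model P P2 PM.
  move=> /in_GenP MX; apply/PX; apply: Tors_generated (fN Ps) _ => //.
  by apply: generated_add MX; have [] := (add_eqP _ _).1 NM.
tfae.
(* Silting identifies [Tors f] with the modules generated by [N]; the resulting universal element
   gives an approximation for the torsion class of [P] itself. *)
- move=> [P [[P2 Ps] PM]]; exists P.
  have [A [B [N [f [p [[Ap Bp fp NM] [PX fN fgen]]]]]]] := model P P2 PM.
  have fT X : Tors f X <-> generated_by N X.
    split; first exact: fgen.
    by apply: Tors_generated => //; apply: fN; case: Ps.
  have [A' [B' [N' [X [f' [p' [z [t [NN' ap]]]]]]]]] :=
    approximating_presentation_exists Ap Bp fp fT.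
  split=> //; first by split=> //; case: Ps.
  have [MN N_M] := (add_eqP _ _).1 NM.
  have N'M := add_eq_trans (add_eq_sym NN') NM.
  have := approximating_presentation_approx ap N'M.
  apply: approx_seq_sub => Y MY.
    by apply/PX/fT/(generated_add N_M)/in_add_generated.
  by apply: generated_add MN _; apply/fT/PX.
(* Presilting puts [Gen M] inside the torsion class, so the approximation restricts. *)
- move=> [P [[P2 Ps] PM MP]]; exists P; split=> //.
  apply: approx_seq_sub MP => [X MX|]; last exact: torsion_Gen.
  exact/in_GenP/in_add_generated.
- move=> [P [P2 PM MP]]; exists P; split=> //.
  by apply: approx_seq_sub MP => // X MX; apply/in_GenP/in_add_generated.
(* The approximation enlarges [P] to a complex whose torsion class is exactly [Gen M]. *)
- move=> [P [[P2 Ps] PM MP]].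
  have [A [B [N [f [p [[Ap Bp fp NM] [PX fN _]]]]]]] := model P P2 PM.
  have [S [S2 SM SX]] := approx_seq_torsion Ap Bp fp (fN Ps) NM MP.
  by exists S; split=> // X; rewrite SX; symmetry; apply: in_GenP.
(* The silting complex is not [P] but a new one, built from a power of its presentation. *)
- move=> [P [P2 PM PT]].
  have [A [B [N [f [p [[Ap Bp fp NM] [PX _ _]]]]]]] := model P P2 PM.
  have [MN N_M] := (add_eqP _ _).1 NM.
  have fT X : Tors f X <-> generated_by N X.
    rewrite -PX PT in_GenP.
    by split; apply: generated_add.
  have [A' [B' [N' [X [f' [p' [z [t [NN' ap]]]]]]]]] :=
    approximating_presentation_exists Ap Bp fp fT.
  have [S [S2 SN]] := approximating_presentation_silting ap.
  exists S; split=> //.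
  exact: add_eq_trans SN (add_eq_trans (add_eq_sym NN') NM).
Qed.
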